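(* The reductions $\to_{\mathsf{bc}}$ and $\to_{\mathsf{ex}}$ are sound: for $R\in\{\to_{\mathsf{bc}},\to_{\mathsf{ex}}\}$, whenever $B\mathrel{R}C$ and $\Phi$ is an $\mathsf{SKS}$ derivation with associated atomic flow $B$, there is an $\mathsf{SKS}$ derivation $\Psi$ with associated atomic flow $C$ and with the same premiss and conclusion as $\Phi$.
   Context: Formulae are built from the units $\mathsf f$ and $\mathsf t$, atoms, disjunction $[\alpha\vee\beta]$ and conjunction $(\alpha\wedge\beta)$; on atoms there is an involution $a\mapsto\bar a$ with $\bar a\neq a$. An inference step of a rule $\alpha/\beta$ rewrites $\xi\{\alpha\}$ into $\xi\{\beta\}$ for an arbitrary context (formula with a hole) $\xi$. A derivation from $\alpha$ (premiss) to $\beta$ (conclusion) is a finite chain of steps from $\alpha$ to $\beta$. System $\mathsf{SKS}$: interaction $\mathsf t/[a\vee\bar a]$; weakening $\mathsf f/a$; contraction $[a\vee a]/a$; cut $(a\wedge\bar a)/\mathsf f$; coweakening $a/\mathsf t$; cocontraction $a/(a\wedge a)$; switch $(\alpha\wedge[\beta\vee\gamma])/[(\alpha\wedge\beta)\vee\gamma]$; medial $[(\alpha\wedge\beta)\vee(\gamma\wedge\delta)]/([\alpha\vee\gamma]\wedge[\beta\vee\delta])$; and $\gamma/\delta$ whenever $\gamma=\delta$ is (either direction of) an instance of commutativity or associativity of $\vee,\wedge$, $[\alpha\vee\mathsf f]=\alpha$, $(\alpha\wedge\mathsf t)=\alpha$, $[\mathsf t\vee\mathsf t]=\mathsf t$,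 $(\mathsf f\wedge\mathsf f)=\mathsf f$. An atomic flow is a tuple $(V,E,\eta,up,lo)$: finite vertex and edge sets, labels interaction, cut, weakening, coweakening, contraction, cocontraction, and maps $up:E\to V\cup\{\top\}$, $lo:E\to V\cup\{\bot\}$. Upper edges of $\nu$: $lo(\epsilon)=\nu$; lower edges: $up(\epsilon)=\nu$. (Upper, lower) edge numbers: $(0,2)$ interaction, $(2,0)$ cut, $(0,1)$ weakening, $(1,0)$ coweakening, $(2,1)$ contraction, $(1,2)$ cocontraction; no directed cycles; a sign map $\pi:E\to\{+,-\}$ exists giving all edges of a (co)contraction the same sign and the two edges of an interaction/cut different signs. Edges with $up=\top$ ($lo=\bot$) are the flow's upper (lower) edges. The atomic flow of an $\mathsf{SKS}$ derivation traces atom occurrences (occurrences in contexts and instantiated subformulae of switch, medial, $=$ keep their edge); each step of an atomic rule gives a vertex with that label, upper edges being the redex occurrences of the step's premiss and lower edges those of its conclusion; occurrences in the premiss/conclusion of the derivation have $up=\top$ / $lo=\bot$. Paths: a path is a sequence $\epsilon_1,\dots,\epsilon_h$ with $lo(\epsilon_i)=up(\epsilon_{i+1})$ (or its reversal); an $\mathsf{ai}$-path is a concatenation of paths $p_1,\dots,p_m$ where consecutive ones meet at an interaction or cut vertex with distinct edges at the junction; it is maximal if no $\mathsf{ai}$-path containing its edges is longer; an $\mathsf{ai}$-cycle is an $\mathsf{ai}$-path from a vertex to itself with no repeated edge; a fragile cycle is an $\mathsf{ai}$-cycle containing a simple edge (an edge from an interaction to a cut); an $\mathsf{ai}$-connection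 is a path between an interaction and a cut; a clean path is an $\mathsf{ai}$-path all of whose $\mathsf{ai}$-connections are simple edges; an extremal simple edge is an edge $\epsilon_k$ such that for some maximal $\mathsf{ai}$-path $\epsilon_1,\dots,\epsilon_h$ that is clean, $\epsilon_k$ is simple and $\epsilon_{k+1},\dots,\epsilon_h$ are not. Splitting and gluing: for a simple edge $\epsilon$ of $B$ from interaction $\iota$ to cut $\kappa$, let $\epsilon_2$ be $\iota$'s other lower edge, $\epsilon_3$ $\kappa$'s other upper edge, $A$ the flow obtained by deleting $\iota,\kappa,\epsilon$, and $\epsilon_1,\dots,\epsilon_h$, $\epsilon'_1,\dots,\epsilon'_k$ the other upper and lower edges of $A$. $B'$ is a copy $\tilde A$ of $A$ with $\tilde\epsilon_2$ made the lower edge of a new weakening; $B''$ is a copy $\hat A$ of $A$ with $\hat\epsilon_3$ made the upper edge of a new coweakening. For flows $D',D''$ whose upper/lower edges correspond one-to-one to those of $B',B''$, $\mathrm{Glue}(D',D'')$ identifies edge $\tilde\epsilon_3$ of $D'$ with edge $\hat\epsilon_2$ of $D''$ into one edge, adds for each $i$ a cocontraction with upper edge $\epsilon_i$ and lower edges $\tilde\epsilon_i,\hat\epsilon_i$, and for each $j$ a contraction with upper edges $\tilde\epsilon'_j,\hat\epsilon'_j$ and lower edge $\epsilon'_j$. $\to_{\mathsf{bc}}$: if $B$ has no fragile cycle then $B\to_{\mathsf{bc}}B$; if $\epsilon$ is a simple edge of $B$ lying on an $\mathsf{ai}$-cycle, $B'\to_{\mathsf{bc}}D'$ and $B''\to_{\mathsf{bc}}D''$,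 then $B\to_{\mathsf{bc}}\mathrm{Glue}(D',D'')$. $\to_{\mathsf{ex}}$: if $B$ has no extremal simple edge then $B\to_{\mathsf{ex}}B$; if $\epsilon$ is an extremal simple edge of $B$, $B'\to_{\mathsf{ex}}D'$ and $B''\to_{\mathsf{ex}}D''$, then $B\to_{\mathsf{ex}}\mathrm{Glue}(D',D'')$. *)

(* Defs.v *)
From HB Require Import structures.
From mathcomp Require Import all_boot.

Set Implicit Arguments.
Unset Strict Implicit.
Unset Printing Implicit Defensive.

Inductive form (X : Type) : Type :=
  | FF | TT | At of X | FOr of form X & form X | FAnd of form X & form X.
Arguments FF {X}. Arguments TT {X}.

Inductive ctx (X : Type) : Type :=
  | Hole
  | COrL of ctx X & form X
  | COrR of form X & ctx X
  | CAndL of ctx X & form X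
  | CAndR of form X & ctx X.
Arguments Hole {X}.

Fixpoint plug X (c : ctx X) (a : form X) : form X :=
  match c with
  | Hole => a
  | COrL c g => FOr (plug c a) g
  | COrR g c => FOr g (plug c a)
  | CAndL c g => FAnd (plug c a) g
  | CAndR g c => FAnd g (plug c a)
  end.

Inductive srule :=
  | SSwitch | SMedial
  | SCommOr | SCommAnd                       (* self-inverse *)
  | SAssocOr | SAssocOrI | SAssocAnd | SAssocAndI
  | SUnitOr | SUnitOrI | SUnitAnd | SUnitAndI
  | STT | STTI | SFF | SFFI.

Definition sapply X (r : srule) (a : form X) : option (form X) :=
  match r, a with
  | SSwitch, FAnd a (FOr b c) => Some (FOr (FAnd a b) c)
  | SMedial, FOr (FAnd a b) (FAnd c d) => Some (FAnd (FOr a c) (FOr b d))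
  | SCommOr, FOr a b => Some (FOr b a)
  | SCommAnd, FAnd a b => Some (FAnd b a)
  | SAssocOr, FOr a (FOr b c) => Some (FOr (FOr a b) c)
  | SAssocOrI, FOr (FOr a b) c => Some (FOr a (FOr b c))
  | SAssocAnd, FAnd a (FAnd b c) => Some (FAnd (FAnd a b) c)
  | SAssocAndI, FAnd (FAnd a b) c => Some (FAnd a (FAnd b c))
  | SUnitOr, FOr a FF => Some a
  | SUnitOrI, a => Some (FOr a FF)
  | SUnitAnd, FAnd a TT => Some a
  | SUnitAndI, a => Some (FAnd a TT)
  | STT, FOr TT TT => Some TT
  | STTI, TT => Some (FOr TT TT)
  | SFF, FAnd FF FF => Some FF
  | SFFI, FF => Some (FAnd FF FF)
  | _, _ => None
  end.

Inductive arule := AInt | ACutR | AWeak | ACoweak | ACont | ACocont.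

Inductive rule (X : Type) := RS of srule | RA of arule & X.

Definition step X := (ctx X * rule X)%type.

Section SKS.
Variables (A : eqType) (bar : A -> A).

Definition rinst (r : rule A) (a b : form A) : Prop :=
  match r with
  | RS s => sapply s a = Some b
  | RA AInt x => a = TT /\ b = FOr (At x) (At (bar x))
  | RA AWeak x => a = FF /\ b = At x
  | RA ACont x => a = FOr (At x) (At x) /\ b = At x
  | RA ACutR x => a = FAnd (At x) (At (bar x)) /\ b = FF
  | RA ACoweak x => a = At x /\ b = TT
  | RA ACocont x => a = At x /\ b = FAnd (At x) (At x)
  end.

Inductive derivation : form A -> seq (step A) -> form A -> Prop :=
  | der_nil P : derivation P [::] P
  | der_cons (xi : ctx A) (r : rule A) (a b Q : form A) (s : seq (step A)) :
      rinst r a b -> derivation (plug xi b) s Q ->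
      derivation (plug xi a) ((xi, r) :: s) Q.

End SKS.

Inductive vlab := VI | VCut | VW | VCW | VC | VCC.

Definition is_int (l : vlab) : bool := if l is VI then true else false.
Definition is_cut (l : vlab) : bool := if l is VCut then true else false.

(* A (pre-)atomic flow: finite vertex and edge sets, vertex labels, maps
   up : E -> V + {top} and lo : E -> V + {bot} (None = top, resp. bot),
   and the lists of its upper edges (up = top) and lower edges (lo = bot)
   in the order in which they correspond to the atom occurrences of the
   premiss, resp. conclusion (and, for Glue, to the boundary edges of
   another flow). *)
Record flow := Flow {
  fV : finType;
  fE : finType;
  flab : fV -> vlab;
  fup : fE -> option fV;
  flo : fE -> option fV;
  ftop : seq fE;
  fbot : seq fE }.

Definition flow_iso (B C : flow) : Prop :=
  exists (fv : fV B -> fV C) (fe : fE B -> fE C),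
    [/\ bijective fv, bijective fe & forall v, flab (fv v) = flab v] /\
    [/\ (forall e, fup (fe e) = omap fv (fup e)),
        (forall e, flo (fe e) = omap fv (flo e)),
        ftop C = map fe (ftop B) & fbot C = map fe (fbot B)].

Fixpoint atoms X (f : form X) : seq X :=
  match f with
  | FF | TT => [::]
  | At x => [:: x]
  | FOr a b | FAnd a b => atoms a ++ atoms b
  end.

Fixpoint lab_form X (n : nat) (f : form X) : form nat * nat :=
  match f with
  | FF => (FF, n)
  | TT => (TT, n)
  | At _ => (At n, n.+1)
  | FOr a b => let (a', n1) := lab_form n a in
               let (b', n2) := lab_form n1 b in (FOr a' b', n2)
  | FAnd a b => let (a', n1) := lab_form n a in
                let (b', n2) := lab_form n1 b in (FAnd a' b', n2)
  end.

Fixpoint at_ctx X Y (c : ctx Y) (f : form X) : option (form X) :=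
  match c, f with
  | Hole, _ => Some f
  | COrL c _, FOr a _ => at_ctx c a
  | COrR _ c, FOr _ b => at_ctx c b
  | CAndL c _, FAnd a _ => at_ctx c a
  | CAndR _ c, FAnd _ b => at_ctx c b
  | _, _ => None
  end.

Fixpoint put_ctx X Y (c : ctx Y) (f r : form X) : form X :=
  match c, f with
  | Hole, _ => r
  | COrL c _, FOr a b => FOr (put_ctx c a r) b
  | COrR _ c, FOr a b => FOr a (put_ctx c b r)
  | CAndL c _, FAnd a b => FAnd (put_ctx c a r) b
  | CAndR _ c, FAnd a b => FAnd a (put_ctx c b r)
  | _, _ => f
  end.

(* State of the flow construction: the current formula whose atom
   occurrences are labelled by edge names (nat), the list of vertex labels
   (vertex i has label nth i), for each edge its upper end (None = top),
   and the list of pairs (edge, vertex) recording lo(edge) = vertex. *)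
Record bstate := BSt {
  bcur : form nat;
  bvl : seq vlab;
  bups : seq (option nat);
  blos : seq (nat * nat) }.

Definition lstep X (s : bstate) (st : step X) : bstate :=
  let (c, r) := st in
  match at_ctx c (bcur s) with
  | None => s
  | Some R =>
    let nv := size (bvl s) in
    let ne := size (bups s) in
    let mk R' vl ups los := BSt (put_ctx c (bcur s) R') vl ups los in
    match r with
    | RS sr => match sapply sr R with
               | Some R' => mk R' (bvl s) (bups s) (blos s)
               | None => s
               end
    | RA ar _ =>
      match ar, R with
      | AInt, TT => mk (FOr (At ne) (At ne.+1)) (rcons (bvl s) VI)
                     (bups s ++ [:: Some nv; Some nv]) (blos s)
      | AWeak, FF => mk (At ne) (rcons (bvl s) VW) (rcons (bups s) (Some nv)) (blos s)
      | ACont, FOr (At e1) (At e2) =>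
          mk (At ne) (rcons (bvl s) VC) (rcons (bups s) (Some nv))
             (blos s ++ [:: (e1, nv); (e2, nv)])
      | ACutR, FAnd (At e1) (At e2) =>
          mk FF (rcons (bvl s) VCut) (bups s) (blos s ++ [:: (e1, nv); (e2, nv)])
      | ACoweak, At e => mk TT (rcons (bvl s) VCW) (bups s) (rcons (blos s) (e, nv))
      | ACocont, At e => mk (FAnd (At ne) (At ne.+1)) (rcons (bvl s) VCC)
                        (bups s ++ [:: Some nv; Some nv]) (rcons (blos s) (e, nv))
      | _, _ => s
      end
    end
  end.

Definition flow_state X (P : form X) (s : seq (step X)) : bstate * nat :=
  let (L, n) := lab_form 0 P in
  (foldl (@lstep X) (BSt L [::] (nseq n None) [::]) s, n).

(* The atomic flow associated with the derivation with premiss P and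
   steps s: edges are the atom occurrences (premiss occurrences are edges
   0..n-1, with up = top), each atomic step yields a vertex; occurrences in
   contexts and in the instantiated subformulae of switch, medial and the
   equations keep their edge. *)
Definition flow_of X (P : form X) (s : seq (step X)) : flow :=
  let (st, n) := flow_state P s in
  @Flow 'I_(size (bvl st)) 'I_(size (bups st))
    (fun v => nth VI (bvl st) v)
    (fun e => obind (fun u => insub u) (nth None (bups st) e))
    (fun e => obind (fun u => insub u)
                (ohead [seq p.2 | p <- blos st & p.1 == val e]))
    (pmap (fun u => insub u) (iota 0 n))
    (pmap (fun u => insub u) (atoms (bcur st))).

Section Paths.
Variable B : flow.

(* an edge traversed downwards (true: from up to lo) or upwards (false) *)
Definition oedge := (fE B * bool)%type.

Definition sv (x : oedge) := if x.2 then fup x.1 else flo x.1.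
Definition ev (x : oedge) := if x.2 then flo x.1 else fup x.1.

Definition continues (x y : oedge) : bool :=
  (x.2 == y.2) && (ev x != None) && (ev x == sv y).

Definition junction (x y : oedge) : bool :=
  (x.1 != y.1) && (ev x == sv y) &&
  match ev x with
  | Some v => (~~ x.2 && y.2 && is_int (flab v)) || (x.2 && ~~ y.2 && is_cut (flab v))
  | None => false
  end.

Definition dpath (p : seq oedge) : bool :=
  if p is x :: s then path continues x s else false.

Definition ai_path (p : seq oedge) : bool :=
  if p is x :: s then path (fun x y => continues x y || junction x y) x s
  else false.

Definition edges (p : seq oedge) : seq (fE B) := map fst p.

Definition pstart (p : seq oedge) : option (fV B) :=
  if p is x :: _ then sv x else None.
Definition pend (p : seq oedge) : option (fV B) :=
  if p is x :: s then ev (last x s) else None.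

Definition ai_cycle (p : seq oedge) : bool :=
  [&& ai_path p, uniq (edges p), pstart p != None & pstart p == pend p].

Definition simple (e : fE B) : bool :=
  match fup e, flo e with
  | Some u, Some v => is_int (flab u) && is_cut (flab v)
  | _, _ => false
  end.

Definition fragile_cycle (p : seq oedge) : Prop :=
  ai_cycle p /\ has simple (edges p).

Definition has_fragile_cycle : Prop := exists p, fragile_cycle p.

Definition on_ai_cycle (e : fE B) : Prop :=
  exists p, ai_cycle p /\ e \in edges p.

Definition ai_connection (p : seq oedge) : bool :=
  dpath p &&
  match pstart p, pend p with
  | Some u, Some v => (is_int (flab u) && is_cut (flab v))
                      || (is_cut (flab u) && is_int (flab v))
  | _, _ => false
  end.

Definition clean (p : seq oedge) : Prop :=
  ai_path p /\
  forall i j, ai_connection (take j (drop i p)) ->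
     size (take j (drop i p)) = 1 /\ all simple (edges (take j (drop i p))).

Definition maximal (p : seq oedge) : Prop :=
  ai_path p /\
  forall q, ai_path q -> {subset edges p <= edges q} -> size q <= size p.

Definition extremal (e : fE B) : Prop :=
  exists (p : seq oedge) (k : nat),
    [/\ clean p, maximal p, k < size p & (nth (e, true) p k).1 = e] /\
    simple e /\
    forall j, k < j < size p -> ~~ simple (nth (e, true) p j).1.

End Paths.

Section Split.
Variables (B : flow) (eps : fE B).

Definition eps2 : option (fE B) := [pick e | (e != eps) && (fup e == fup eps)].
Definition eps3 : option (fE B) := [pick e | (e != eps) && (flo e == flo eps)].

Definition keepV : pred (fV B) := fun v => (Some v != fup eps) && (Some v != flo eps).
Definition keepE : pred (fE B) := fun e => e != eps.
Definition VA : finType := {v : fV B | keepV v}.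
Definition EA : finType := {e : fE B | keepE e}.

Definition upA (e : EA) : option VA := obind (fun v => insub v) (fup (val e)).
Definition loA (e : EA) : option VA := obind (fun v => insub v) (flo (val e)).

Definition oseq T (o : option T) : seq T := if o is Some x then [:: x] else [::].

(* B': a copy of A with eps2 made the lower edge of a new weakening (None) *)
Definition splitW : flow :=
  @Flow (option VA) EA
    (fun v => if v is Some v then flab (val v) else VW)
    (fun e => if Some (val e) == eps2 then Some None else omap Some (upA e))
    (fun e => omap Some (loA e))
    (pmap (fun e => insub e) (ftop B))
    (pmap (fun e => insub e) (fbot B ++ oseq eps3)).

Definition splitCW : flow :=
  @Flow (option VA) EA
    (fun v => if v is Some v then flab (val v) else VCW)
    (fun e => omap Some (upA e))
    (fun e => if Some (val e) == eps3 then Some None else omap Some (loA e))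
    (pmap (fun e => insub e) (ftop B ++ oseq eps2))
    (pmap (fun e => insub e) (fbot B)).

End Split.

Section Glue.
Variables (B D1 D2 : flow).
(* D1 plays the role of D' (boundary as B'), D2 of D'' (boundary as B'') *)

Let h := size (ftop B).
Let k := size (fbot B).

Definition pos (T : eqType) (n : nat) (s : seq T) (x : T) : option 'I_n :=
  insub (index x s).

(* tilde epsilon_3 (last lower edge of D') and hat epsilon_2 (last upper
   edge of D'') *)
Definition e3t : option (fE D1) := ohead (drop k (fbot D1)).
Definition e2h : option (fE D2) := ohead (drop h (ftop D2)).

Definition keep2 : pred (fE D2) := fun f => Some f != e2h.

Definition GV : finType := ((fV D1 + fV D2) + ('I_h + 'I_k))%type.
Definition GE : finType := ((fE D1 + {f : fE D2 | keep2 f}) + ('I_h + 'I_k))%type.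

Definition glab (v : GV) : vlab :=
  match v with
  | inl (inl v) => flab v
  | inl (inr v) => flab v
  | inr (inl _) => VCC
  | inr (inr _) => VC
  end.

Definition up2 (f : fE D2) : option GV :=
  match pos h (ftop D2) f with
  | Some i => Some (inr (inl i))
  | None => omap (fun v => inl (inr v)) (fup f)
  end.

Definition lo2 (f : fE D2) : option GV :=
  match pos k (fbot D2) f with
  | Some j => Some (inr (inr j))
  | None => omap (fun v => inl (inr v)) (flo f)
  end.

Definition gup (e : GE) : option GV :=
  match e with
  | inl (inl e) =>
      match pos h (ftop D1) e with
      | Some i => Some (inr (inl i))
      | None => omap (fun v => inl (inl v)) (fup e)
      end
  | inl (inr f) => up2 (val f)
  | inr (inl i) => None
  | inr (inr j) => Some (inr (inr j))
  end.

Definition glo (e : GE) : option GV :=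
  match e with
  | inl (inl e) =>
      match pos k (fbot D1) e with
      | Some j => Some (inr (inr j))
      | None =>
          if Some e == e3t then (if e2h is Some f then lo2 f else None)
          else omap (fun v => inl (inl v)) (flo e)
      end
  | inl (inr f) => lo2 (val f)
  | inr (inl i) => Some (inr (inl i))
  | inr (inr j) => None
  end.

(* Glue(D', D''): identify tilde-eps3 of D' with hat-eps2 of D'' (the edge
   of D'' is dropped and the edge of D' gets its lower end), add a
   cocontraction for each upper edge eps_i of B (new edge inr (inl i)) and
   a contraction for each lower edge eps'_j of B (new edge inr (inr j)). *)
Definition glue : flow :=
  @Flow GV GE glab gup glo
    [seq inr (inl i) : GE | i <- enum 'I_h]
    [seq inr (inr j) : GE | j <- enum 'I_k].

End Glue.

Inductive red_bc : flow -> flow -> Prop :=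
  | bc_stop B : ~ has_fragile_cycle B -> red_bc B B
  | bc_split B (eps : fE B) D1 D2 :
      simple eps -> on_ai_cycle eps ->
      red_bc (splitW eps) D1 -> red_bc (splitCW eps) D2 ->
      red_bc B (glue B D1 D2).

Inductive red_ex : flow -> flow -> Prop :=
  | ex_stop B : ~ (exists eps : fE B, extremal eps) -> red_ex B B
  | ex_split B (eps : fE B) D1 D2 :
      extremal eps ->
      red_ex (splitW eps) D1 -> red_ex (splitCW eps) D2 ->
      red_ex B (glue B D1 D2).

(* Main.v *)
(* Naming the atom occurrences of a derivation by the edges of its flow turns it
   into a trace, whose atomic steps are the vertices. Let a simple edge carry the
   atom a. Replacing a by t along the edge and pulling the dual atom out with
   switches turns a derivation of Q from P into one of [Q \/ b], b = bar a, whose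
   flow is B'; replacing a by f gives dually a derivation of Q from (P /\ b), whose
   flow is B''. Given derivations for D' and D'' with these premisses and
   conclusions, one obtains
     P -> (P /\ P) -> (P /\ [Q \/ b]) -> [(P /\ b) \/ Q] -> [Q \/ Q] -> Q,
   where the two ends are atomic cocontractions and contractions; its flow is
   Glue(D', D''). *)

Require Import Defs.
From HB Require Import structures.
From mathcomp Require Import all_boot zify.

Set Implicit Arguments.
Unset Strict Implicit.
Unset Printing Implicit Defensive.

(** The reductions speak of flows only: a derivation supplied by the induction hypothesis for [D1]
    or [D2] is known through its premiss, its conclusion and its flow up to isomorphism. Its atom
    occurrences have to be named anew each time, and the numbers used by [flow_of], which follow the
    order of creation, do not survive the deletion of an edge. Traces therefore take names from an
    arbitrary type, and [flow_traced] and [traced_flow] pass between them and flows in both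
    directions. A simple edge can be replaced by a unit because an interaction and a cut are the
    only vertices that touch it: in between, its atom is merely moved by switch, medial and the
    equations, which hold for all formulae. With t for the edge, the interaction becomes a weakening
    inside [t \/ f], while the cut leaves [eps3] where f is expected; this leftover is what is drawn
    out of the context. Both [eps2] and [eps3] carry the dual of the atom of [eps], so a single atom
    b ends the one derivation and starts the other, and the switch can join the two into one
    edge. *)

Fixpoint subst X Y (s : X -> form Y) (f : form X) : form Y :=
  match f with
  | FF => FF
  | TT => TT
  | At x => s x
  | FOr a b => FOr (subst s a) (subst s b)
  | FAnd a b => FAnd (subst s a) (subst s b)
  end.

Fixpoint csubst X Y (s : X -> form Y) (c : ctx X) : ctx Y :=
  match c with
  | Hole => Hole
  | COrL c g => COrL (csubst s c) (subst s g)
  | COrR g c => COrR (subst s g) (csubst s c)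
  | CAndL c g => CAndL (csubst s c) (subst s g)
  | CAndR g c => CAndR (subst s g) (csubst s c)
  end.

Notation fmap f := (subst (fun x => At (f x))).
Notation cmap f := (csubst (fun x => At (f x))).

Lemma subst_plug X Y (s : X -> form Y) c a :
  subst s (plug c a) = plug (csubst s c) (subst s a).
Proof. by elim: c => //= [c -> | g c -> | c -> | g c ->]. Qed.

Lemma subst_comp X Y Z (s : X -> form Y) (t : Y -> form Z) a :
  subst t (subst s a) = subst (fun x => subst t (s x)) a.
Proof. by elim: a => //= a -> b ->. Qed.

Lemma eq_in_subst (X : eqType) Y (s t : X -> form Y) a :
  {in atoms a, s =1 t} -> subst s a = subst t a.
Proof.
elim: a => //= [x|a IHa b IHb|a IHa b IHb] st; first by rewrite st ?mem_head.
  by rewrite IHa ?IHb // => x xa; apply: st; rewrite mem_cat xa ?orbT.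
by rewrite IHa ?IHb // => x xa; apply: st; rewrite mem_cat xa ?orbT.
Qed.

Lemma subst_At X (a : form X) : fmap id a = a.
Proof. by elim: a => //= a -> b ->. Qed.

Lemma atoms_fmap X Y (f : X -> Y) a : atoms (fmap f a) = map f (atoms a).
Proof. by elim: a => //= a -> b ->; rewrite map_cat. Qed.

Lemma size_atoms_fmap X Y (f : X -> Y) a :
  size (atoms (fmap f a)) = size (atoms a).
Proof. by rewrite atoms_fmap size_map. Qed.

Notation shape := (fmap (fun _ => tt)).

Lemma cat_inj T (s1 s2 t1 t2 : seq T) :
  size s1 = size t1 -> s1 ++ s2 = t1 ++ t2 -> s1 = t1 /\ s2 = t2.
Proof. by elim: s1 t1 => [|x s1 IH] [|y t1] //= [/IH H] [-> /H[-> ->]]. Qed.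

(** The shape fixes where the list of leaves is cut at each connective, so the list determines the
    labels. Equalities of labelled formulae thereby reduce to equalities of lists. *)
Lemma form_ext X (f g : form X) : shape f = shape g -> atoms f = atoms g -> f = g.
Proof.
have sh (a b : form X) : shape a = shape b -> size (atoms a) = size (atoms b).
  by move=> ab; rewrite -(size_atoms_fmap (fun=> tt)) ab size_atoms_fmap.
elim: f g => [||x|f1 IH1 f2 IH2|f1 IH1 f2 IH2] [||y|g1 g2|g1 g2] //=.
- by move=> _ [->].
- by move=> [H1 H2] /(cat_inj (sh _ _ H1))[/(IH1 _ H1)-> /(IH2 _ H2)->].
- by move=> [H1 H2] /(cat_inj (sh _ _ H1))[/(IH1 _ H1)-> /(IH2 _ H2)->].
Qed.

Lemma form_relabel X Y (f : form X) (l : seq Y) :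
  size l = size (atoms f) -> exists2 F, shape F = shape f & atoms F = l.
Proof.
elim: f l => [||x|f1 IH1 f2 IH2|f1 IH1 f2 IH2] l /=.
- by case: l => // _; exists FF.
- by case: l => // _; exists TT.
- by case: l => [|y []] // _; exists (At y).
all: rewrite size_cat => sl; have [|F1 sh1 at1] := IH1 (take (size (atoms f1)) l).
- by rewrite size_takel // sl leq_addr.
- have [|F2 sh2 at2] := IH2 (drop (size (atoms f1)) l).
    by rewrite size_drop sl addKn.
  by exists (FOr F1 F2); rewrite /= ?sh1 ?sh2 // at1 at2 cat_take_drop.
- by rewrite size_takel // sl leq_addr.
- have [|F2 sh2 at2] := IH2 (drop (size (atoms f1)) l).
    by rewrite size_drop sl addKn.
  by exists (FAnd F1 F2); rewrite /= ?sh1 ?sh2 // at1 at2 cat_take_drop.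
Qed.

Lemma sapply_subst X Y (s : X -> form Y) r a b :
  sapply r a = Some b -> sapply r (subst s a) = Some (subst s b).
Proof.
case: r => /=;
  repeat match goal with
  | |- context [match ?a with FF => _ | _ => _ end] => is_var a; case: a => //=
  | |- forall _, _ => intro
  end; try by case: H => <-.
all: congruence.
Qed.

Lemma sapply_fmap_inv X Y (g : X -> Y) r a b :
  sapply r (fmap g a) = Some b -> exists2 a', sapply r a = Some a' & fmap g a' = b.
Proof.
case: r => /= H;
  repeat match type of H with
  | context [match subst _ ?a with FF => _ | _ => _ end] =>
      destruct a; simpl in H; try discriminate H
  end; case: H => <-; by eexists; first reflexivity.
Qed.

(** [at_ctx] and [put_ctx] read only the path to the hole, never the labels of the side formulae.
    The context of a derivation step, with atoms in [A], can therefore be applied to the formula of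
    numbers kept by the builder. *)
Lemma at_put_ctx X Y Z T (k : X -> Y) (l : X -> Z) (g : T -> Y) c L a :
  fmap g L = plug (cmap k c) a ->
  exists R, [/\ at_ctx (cmap l c) L = Some R, fmap g R = a
    & forall R', fmap g (put_ctx (cmap l c) L R') = plug (cmap k c) (fmap g R')].
Proof.
elim: c L => [|c IH f|f c IH|c IH f|f c IH] L /=.
  by move=> La; exists L; split; rewrite //; case: (L).
all: case: L => //= L1 L2 [H1 H2].
- by have [R [-> Ra HR]] := IH _ H1; exists R; split=> // R'; rewrite HR H2.
- by have [R [-> Ra HR]] := IH _ H2; exists R; split=> // R'; rewrite HR H1.
- by have [R [-> Ra HR]] := IH _ H1; exists R; split=> // R'; rewrite HR H2.
- by have [R [-> Ra HR]] := IH _ H2; exists R; split=> // R'; rewrite HR H1.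
Qed.

Fixpoint ccomp X (c d : ctx X) : ctx X :=
  match c with
  | Hole => d
  | COrL c g => COrL (ccomp c d) g
  | COrR g c => COrR g (ccomp c d)
  | CAndL c g => CAndL (ccomp c d) g
  | CAndR g c => CAndR g (ccomp c d)
  end.

Lemma plug_ccomp X (c d : ctx X) a : plug (ccomp c d) a = plug c (plug d a).
Proof. by elim: c => //= [c -> | g c -> | c -> | g c ->]. Qed.

Fixpoint catoms X (c : ctx X) : seq X :=
  match c with
  | Hole => [::]
  | COrL c g | CAndL c g => catoms c ++ atoms g
  | COrR g c | CAndR g c => atoms g ++ catoms c
  end.

Lemma atoms_plug (X : eqType) (c : ctx X) a :
  perm_eq (atoms (plug c a)) (atoms a ++ catoms c).
Proof.
elim: c => /= [|c IH g|g c IH|c IH g|g c IH]; rewrite ?cats0 //.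
- by rewrite catA perm_cat2r.
- by rewrite perm_sym perm_catCA perm_cat2l perm_sym.
- by rewrite catA perm_cat2r.
- by rewrite perm_sym perm_catCA perm_cat2l perm_sym.
Qed.

Lemma atoms_sapply (X : eqType) r (a b : form X) :
  sapply r a = Some b -> perm_eq (atoms a) (atoms b).
Proof.
case: r => /= H;
  repeat match type of H with
  | context [match ?a with FF => _ | _ => _ end] =>
      is_var a; destruct a; simpl in H; try discriminate H
  end; case: H => <- /=; rewrite ?cats0 ?catA //.
- by rewrite -!catA perm_cat2l perm_catCA.
- by rewrite perm_catC.
- by rewrite perm_catC.
Qed.

(** * Traces and their simulation by the flow builder *)

Record event (E V : Type) :=
  Ev { er : arule; ev_vtx : V; ev_in : seq E; ev_out : seq E }.
Arguments Ev {E V}.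

Definition vlab_of (r : arule) : vlab :=
  match r with
  | AInt => VI | ACutR => VCut | AWeak => VW
  | ACoweak => VCW | ACont => VC | ACocont => VCC
  end.

Notation labs evs := (map (fun ev => vlab_of (er ev)) evs).
Notation vtxs evs := (map (@ev_vtx _ _) evs).
Notation ins evs := (flatten (map (@ev_in _ _) evs)).
Notation outs evs := (flatten (map (@ev_out _ _) evs)).

(** Only the form of the redex is fixed here. That the atoms are equal or dual is imposed on the
    labels, by [rinst] in [tr_ev]. *)
Inductive ainst E : arule -> seq E -> seq E -> form E -> form E -> Prop :=
  | ai_int e1 e2 : ainst AInt [::] [:: e1; e2] TT (FOr (At e1) (At e2))
  | ai_cut e1 e2 : ainst ACutR [:: e1; e2] [::] (FAnd (At e1) (At e2)) FF
  | ai_weak e : ainst AWeak [::] [:: e] FF (At e)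
  | ai_coweak e : ainst ACoweak [:: e] [::] (At e) TT
  | ai_cont e1 e2 e :
      ainst ACont [:: e1; e2] [:: e] (FOr (At e1) (At e2)) (At e)
  | ai_cocont e e1 e2 :
      ainst ACocont [:: e] [:: e1; e2] (At e) (FAnd (At e1) (At e2)).

Section Trace.
Variables (A : eqType) (bar : A -> A) (E : eqType) (lam : E -> A).

(* A derivation whose atom occurrences are named by edges: [lam] gives the atom
   named by an edge, and the list of events records the vertices in order. *)
Inductive trace (V : Type) : form E -> seq (event E V) -> form E -> Prop :=
  | tr_nil F : trace F [::] F
  | tr_str xi r a b evs G :
      sapply r a = Some b -> trace (plug xi b) evs G -> trace (plug xi a) evs G
  | tr_ev xi r v us ls x a b evs G :
      ainst r us ls a b -> rinst bar (RA r x) (fmap lam a) (fmap lam b) ->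
      trace (plug xi b) evs G -> trace (plug xi a) (Ev r v us ls :: evs) G.

Variable V : Type.
Implicit Types (F G : form E) (evs : seq (event E V)).

(** [newups] and [newlos] predict what the builder appends to [bups] and [blos] when the next vertex
    has number [n]. *)
Fixpoint newups (n : nat) evs : seq (option nat) :=
  if evs is ev :: evs then nseq (size (ev_out ev)) (Some n) ++ newups n.+1 evs
  else [::].

Fixpoint newlos (n : nat) evs : seq (option E * nat) :=
  if evs is ev :: evs then [seq (Some e, n) | e <- ev_in ev] ++ newlos n.+1 evs
  else [::].

(* The numbers used by [flow_state] are decoded by [g]; out of range numbers
   decode to [None]. *)
Definition runs (Psi : seq (step A)) F evs G : Prop :=
  forall (g : nat -> option E) (s : bstate),
    fmap g (bcur s) = fmap Some F ->
    map g (iota (size (bups s)) (size (outs evs))) = map Some (outs evs) ->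
    let st := foldl (@lstep A) s Psi in
    [/\ fmap g (bcur st) = fmap Some G,
        bvl st = bvl s ++ labs evs,
        bups st = bups s ++ newups (size (bvl s)) evs
      & exists2 los, blos st = blos s ++ los
          & [seq (g p.1, p.2) | p <- los] = newlos (size (bvl s)) evs].

Lemma runs_nil F : runs [::] F [::] F.
Proof. by move=> g s Hs _; split; rewrite ?cats0 //; exists [::]; rewrite ?cats0. Qed.

Lemma runs_str Psi xi r a b evs G :
  sapply r a = Some b -> runs Psi (plug xi b) evs G ->
  runs ((cmap lam xi, RS _ r) :: Psi) (plug xi a) evs G.
Proof.
move=> ab run g s; rewrite subst_plug => Hs Hg /=.
have [R [atR Ra putR]] := at_put_ctx lam Hs.
have [|R' RR' R'b] := @sapply_fmap_inv _ _ g r R (fmap Some b).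
  by rewrite Ra; apply: sapply_subst.
by rewrite atR RR'; apply: (run g) => //=; rewrite putR R'b subst_plug.
Qed.

Lemma runs_ev Psi xi r v us ls x a b evs G :
  ainst r us ls a b -> runs Psi (plug xi b) evs G ->
  runs ((cmap lam xi, RA r x) :: Psi) (plug xi a) (Ev r v us ls :: evs) G.
Proof.
move=> ab run g s; rewrite subst_plug => Hs /=.
have [R [atR Ra putR]] := at_put_ctx lam Hs.
(* The numbers still to be allocated split into those of this step, which decode to [ls], and those
   of the remaining events. *)
rewrite atR size_cat iotaD !map_cat => /eqP; rewrite eqseq_cat ?size_map ?size_iota //.
case/andP=> /eqP Hls /eqP Hg.
case: ab Ra Hls Hg run => [e1 e2|e1 e2|e|e|e1 e2 e|e e1 e2] /=.
- case: R atR => //= atR _ [] ge1 ge2 Hg run.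
  have [||-> -> -> [los -> Hl]] := run g (BSt (put_ctx (cmap lam xi) (bcur s)
     (FOr (At (size (bups s))) (At (size (bups s)).+1))) (rcons (bvl s) VI)
     (bups s ++ [:: Some (size (bvl s)); Some (size (bvl s))]) (blos s)).
  + by rewrite putR /= ge1 ge2 subst_plug.
  + by rewrite /= size_cat.
  rewrite /= size_rcons cat_rcons -!catA; split=> //.
  by exists los => //; rewrite Hl size_rcons.
- case: R atR => //= -[] // n1 [] // n2 atR [] ge1 ge2 _ Hg run.
  have [||-> -> -> [los -> Hl]] := run g (BSt (put_ctx (cmap lam xi) (bcur s) FF)
     (rcons (bvl s) VCut) (bups s)
     (blos s ++ [:: (n1, size (bvl s)); (n2, size (bvl s))])).
  + by rewrite putR /= subst_plug.
  + by rewrite /= -[X in iota X]addn0.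
  rewrite /= size_rcons cat_rcons -!catA; split=> //.
  by eexists; first reflexivity; rewrite /= Hl /= ge1 ge2 size_rcons.
- case: R atR => //= atR _ [] ge Hg run.
  have [||-> -> -> [los -> Hl]] := run g (BSt (put_ctx (cmap lam xi) (bcur s)
     (At (size (bups s)))) (rcons (bvl s) VW)
     (rcons (bups s) (Some (size (bvl s)))) (blos s)).
  + by rewrite putR /= ge subst_plug.
  + by rewrite /= size_rcons -addn1.
  rewrite /= size_rcons !cat_rcons; split=> //.
  by exists los => //; rewrite Hl size_rcons.
- case: R atR => //= n atR [] ge _ Hg run.
  have [||-> -> -> [los -> Hl]] := run g (BSt (put_ctx (cmap lam xi) (bcur s) TT)
     (rcons (bvl s) VCW) (bups s) (rcons (blos s) (n, size (bvl s)))).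
  + by rewrite putR /= subst_plug.
  + by rewrite /= -[X in iota X]addn0.
  rewrite /= size_rcons !cat_rcons; split=> //.
  by eexists; first reflexivity; rewrite /= Hl /= ge size_rcons.
- case: R atR => //= -[] // n1 [] // n2 atR [] ge1 ge2 [] ge Hg run.
  have [||-> -> -> [los -> Hl]] := run g (BSt (put_ctx (cmap lam xi) (bcur s)
     (At (size (bups s)))) (rcons (bvl s) VC) (rcons (bups s) (Some (size (bvl s))))
     (blos s ++ [:: (n1, size (bvl s)); (n2, size (bvl s))])).
  + by rewrite putR /= ge subst_plug.
  + by rewrite /= size_rcons -addn1.
  rewrite /= size_rcons !cat_rcons -!catA; split=> //.
  by eexists; first reflexivity; rewrite /= Hl /= ge1 ge2 size_rcons.
- case: R atR => //= n atR [] ge [] ge1 ge2 Hg run.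
  have [||-> -> -> [los -> Hl]] := run g (BSt (put_ctx (cmap lam xi) (bcur s)
     (FAnd (At (size (bups s))) (At (size (bups s)).+1))) (rcons (bvl s) VCC)
     (bups s ++ [:: Some (size (bvl s)); Some (size (bvl s))])
     (rcons (blos s) (n, size (bvl s)))).
  + by rewrite putR /= ge1 ge2 subst_plug.
  + by rewrite /= size_cat.
  rewrite /= size_rcons !cat_rcons -!catA; split=> //.
  by eexists; first reflexivity; rewrite /= Hl /= ge size_rcons.
Qed.

Lemma trace_runs F evs G :
  trace F evs G ->
  exists2 Psi, derivation bar (fmap lam F) Psi (fmap lam G) & runs Psi F evs G.
Proof.
elim=> {F evs G} [F|xi r a b evs G ab _ [Psi der run]|
  xi r v us ls x a b evs G ab lab _ [Psi der run]].
- by exists [::]; [left | apply: runs_nil].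
- exists ((cmap lam xi, RS _ r) :: Psi); last exact: runs_str run.
  by rewrite subst_plug; rewrite subst_plug in der; apply: (der_cons _ der); apply: sapply_subst.
- exists ((cmap lam xi, RA r x) :: Psi); last exact: runs_ev run.
  by rewrite subst_plug; rewrite subst_plug in der; apply: (der_cons _ der).
Qed.

End Trace.

(** * Naming the occurrences of a derivation *)

Section ToTrace.
Variables (A : eqType) (bar : A -> A).

Lemma fmap_plug_inv E (lam : E -> A) F xi a :
  fmap lam F = plug xi a ->
  exists xi' a', [/\ F = plug xi' a', cmap lam xi' = xi & fmap lam a' = a].
Proof.
elim: xi F => [|c IH f|f c IH|c IH f|f c IH] F /=; first by exists Hole, F.
all: case: F => //= F1 F2 [H1 H2].
- by have [c' [a' [-> <- <-]]] := IH _ H1; exists (COrL c' F2), a'; rewrite -H2.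
- by have [c' [a' [-> <- <-]]] := IH _ H2; exists (COrR F1 c'), a'; rewrite -H1.
- by have [c' [a' [-> <- <-]]] := IH _ H1; exists (CAndL c' F2), a'; rewrite -H2.
- by have [c' [a' [-> <- <-]]] := IH _ H2; exists (CAndR F1 c'), a'; rewrite -H1.
Qed.

(** The redex already dictates the upper names. Only the lower ones can be chosen, and [L] lists the
    atoms that they must carry. *)
Lemma ainst_lift r x (a b : form A) :
  rinst bar (RA r x) a b ->
  exists L : seq A, forall (E : eqType) (lam : E -> A) a' ls,
    fmap lam a' = a -> map lam ls = L ->
    exists us b', ainst r us ls a' b' /\ fmap lam b' = b.
Proof.
case: r => /= -[-> ->].
- exists [:: x; bar x] => E lam [] // [|e1 [|e2 []]] // _ [<- <-].
  by exists [::], (FOr (At e1) (At e2)); split; first by constructor.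
- exists [::] => E lam [] // [] // e1 [] // e2 [] // _ _.
  by exists [:: e1; e2], FF; split; first by constructor.
- exists [:: x] => E lam [] // [|e []] // _ [<-].
  by exists [::], (At e); split; first by constructor.
- exists [::] => E lam [] // e [] // _ _.
  by exists [:: e], TT; split; first by constructor.
- exists [:: x] => E lam [] // [] // e1 [] // e2 [|e []] // _ [<-].
  by exists [:: e1; e2], (At e); split; first by constructor.
- exists [:: x; x] => E lam [] // e [|e1 [|e2 []]] // _ [<- ?].
  exists [:: e], (FAnd (At e1) (At e2)); split; first by constructor.
  by rewrite /=; congr (FAnd _ (At _)).
Qed.

(** [L] lists the atoms created by the atomic steps in order and [k] counts these steps; both depend
    on the derivation alone. Names are supplied from outside and over any types, so that
    [flow_traced] can run the lemma once with provisional names to learn the sizes and once with the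
    edges and vertices of the flow. *)
Lemma derivation_trace P Phi Q :
  derivation bar P Phi Q ->
  exists (L : seq A) (k : nat),
    forall (E : eqType) (V : Type) (lam : E -> A) F (Ne : seq E) (Nv : seq V),
    fmap lam F = P -> map lam Ne = L -> size Nv = k ->
    exists evs G,
      [/\ trace bar lam F evs G, runs Phi F evs G, fmap lam G = Q,
          outs evs = Ne & vtxs evs = Nv].
Proof.
elim=> {P Phi Q} [P|xi r a b Q Phi ab _ [L [k IH]]].
  exists [::], 0 => E V lam F [] // [] // FP _ _.
  by exists [::], F; split=> //; [apply: tr_nil | apply: runs_nil].
case: r ab => [r|r x] ab.
  exists L, k => E V lam F Ne Nv /fmap_plug_inv[xi' [a' [-> xi'E a'a]]] NeL Nvk.
  have [b' ab' b'b] : exists2 b', sapply r a' = Some b' & fmap lam b' = b.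
    by apply: sapply_fmap_inv; rewrite a'a.
  have [|evs [G [tr run GQ HNe HNv]]] := IH E V lam (plug xi' b') Ne Nv _ NeL Nvk.
    by rewrite subst_plug xi'E b'b.
  exists evs, G; split=> //; first exact: tr_str ab' tr.
  by rewrite -xi'E; apply: runs_str run.
have [L' HL'] := ainst_lift ab.
exists (L' ++ L), k.+1 => E V lam F Ne [|v Nv] //.
move=> /fmap_plug_inv[xi' [a' [-> xi'E a'a]]] NeL [Nvk].
have HNe' : map lam (take (size L') Ne) = L'.
  by rewrite map_take NeL take_size_cat.
have HNe'' : map lam (drop (size L') Ne) = L.
  by rewrite map_drop NeL drop_size_cat.
have [us [b' [ab' b'b]]] := HL' _ _ _ _ a'a HNe'.
have [|evs [G [tr run GQ HNe HNv]]] := IH E V lam (plug xi' b') _ Nv _ HNe'' Nvk.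
  by rewrite subst_plug xi'E b'b.
exists (Ev r v us (take (size L') Ne) :: evs), G; split=> //=.
- by apply: (tr_ev (x := x) v ab' _ tr); rewrite a'a b'b.
- by rewrite -xi'E; apply: runs_ev run.
- by rewrite HNe cat_take_drop.
- by rewrite HNv.
Qed.

End ToTrace.

Definition arule_code (r : arule) : nat :=
  match r with
  | AInt => 0 | ACutR => 1 | AWeak => 2 | ACoweak => 3 | ACont => 4 | ACocont => 5
  end.

Definition arule_decode (n : nat) : arule :=
  nth AInt [:: AInt; ACutR; AWeak; ACoweak; ACont; ACocont] n.

Lemma arule_codeK : cancel arule_code arule_decode. Proof. by case. Qed.

HB.instance Definition _ := Equality.copy arule (can_type arule_codeK).

Definition event_code E V (ev : event E V) :=
  (er ev, ev_vtx ev, ev_in ev, ev_out ev).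

Definition event_decode E V (t : arule * V * seq E * seq E) : event E V :=
  Ev t.1.1.1 t.1.1.2 t.1.2 t.2.

Lemma event_codeK E V : cancel (@event_code E V) (@event_decode E V).
Proof. by case. Qed.

HB.instance Definition _ (E V : eqType) :=
  Equality.copy (event E V) (can_type (@event_codeK E V)).

Lemma onth_uniq (T : eqType) (s : seq T) i x :
  uniq s -> onth s i = Some x -> i = index x s.
Proof.
move=> us six; have lti : i < size s by rewrite -onthTE six.
by rewrite -(@onth_nth _ x x s i six) index_uniq.
Qed.

Lemma onth_index (T : eqType) (s : seq T) x :
  x \in s -> onth s (index x s) = Some x.
Proof.
move=> xs; rewrite onthE (nth_map x) ?index_mem //.
by rewrite nth_index.
Qed.

Lemma map_onth_cat (T : Type) (s t : seq T) :
  map (onth (s ++ t)) (iota (size s) (size t)) = map Some t.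
Proof.
elim: s => [|x s IH] /=; last by rewrite -(addn1 (size s)) addnC iotaDl -map_comp.
by elim: t => //= x t IH; rewrite (iotaDl 1 0) -map_comp /= IH.
Qed.

Lemma map_onth (T : Type) (s t : seq T) :
  map (onth (s ++ t)) (iota 0 (size s)) = map Some s.
Proof. by elim: s => //= x s IH; rewrite (iotaDl 1 0) -map_comp /= IH. Qed.

Lemma map_index_cat (T : eqType) (s t : seq T) :
  uniq s -> map (index^~ (s ++ t)) s = iota 0 (size s).
Proof.
move=> us; apply: (@eq_from_nth _ 0); rewrite ?size_map ?size_iota // => i lti.
have [x0 _] : {x0 : T | True} by case: (s) lti => // x; exists x.
by rewrite (nth_map x0) // index_cat mem_nth // index_uniq // nth_iota.
Qed.

(** * Numbers of edges and vertices in the flow of a trace *)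

Section Bookkeeping.
Variables E V : eqType.
Implicit Types (evs : seq (event E V)).

Lemma vtx_inj evs : uniq (vtxs evs) -> {in evs &, injective (@ev_vtx E V)}.
Proof.
elim: evs => //= ev0 evs IH /andP[v0 uv] ev ev'; rewrite !inE.
case/predU1P=> [->|ein] /predU1P[->|e'in] // vv; last exact: IH.
  by case/negP: v0; rewrite vv map_f.
by case/negP: v0; rewrite -vv map_f.
Qed.

Lemma nth_labs evs ev : uniq (vtxs evs) -> ev \in evs ->
  nth VI (labs evs) (index (ev_vtx ev) (vtxs evs)) = vlab_of (er ev).
Proof.
elim: evs => //= ev0 evs IH /andP[v0 uv]; rewrite inE => /predU1P[->|evin].
  by rewrite eqxx.
case: eqP => [vv|_]; last exact: IH.
by case/negP: v0; rewrite vv map_f.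
Qed.

Lemma nth_newups n evs ev e :
  uniq (vtxs evs) -> uniq (outs evs) -> ev \in evs -> e \in ev_out ev ->
  nth None (newups n evs) (index e (outs evs)) =
    Some (n + index (ev_vtx ev) (vtxs evs)).
Proof.
elim: evs n => //= ev0 evs IH n /andP[v0 uv]; rewrite cat_uniq inE.
case/and3P=> _ dis uo /orP[/eqP-> e0|evin eev].
  by rewrite nth_cat size_nseq index_cat e0 index_mem e0 nth_nseq index_mem e0 eqxx addn0.
have eout : e \in outs evs by apply/flatten_mapP; exists ev.
have /negPf e0 : e \notin ev_out ev0 by apply: contra dis => e0; apply/hasP; exists e.
have /negPf vv0 : ev_vtx ev0 != ev_vtx ev.
  by apply: contra v0 => /eqP->; apply: map_f.
rewrite nth_cat size_nseq index_cat e0 ltnNge leq_addr /= addKn IH // vv0.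
by rewrite addSnnS.
Qed.

Lemma newlos_in n evs ev e :
  uniq (vtxs evs) -> uniq (ins evs) -> ev \in evs -> e \in ev_in ev ->
  ohead [seq p.2 | p <- newlos n evs & p.1 == Some e] =
    Some (n + index (ev_vtx ev) (vtxs evs)).
Proof.
elim: evs n => //= ev0 evs IH n /andP[v0 uv]; rewrite cat_uniq inE filter_cat map_cat.
rewrite filter_map -map_comp.
case/and3P=> _ dis uo /orP[/eqP-> e0|evin eev].
  rewrite eqxx addn0 (eq_filter (a2 := pred1 e)) //.
  have : e \in filter (pred1 e) (ev_in ev0) by rewrite mem_filter /= eqxx.
  by case: filter.
have eout : e \in ins evs by apply/flatten_mapP; exists ev.
have e0 : e \notin ev_in ev0 by apply: contra dis => e0; apply/hasP; exists e.
have /negPf vv0 : ev_vtx ev0 != ev_vtx ev.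
  by apply: contra v0 => /eqP->; apply: map_f.
rewrite (eq_filter (a2 := pred1 e)) // (@eq_in_filter _ (pred1 e) pred0 (ev_in ev0)).
  by rewrite filter_pred0 /= IH // vv0 addSnnS.
by move=> x /= xin; apply/negP => /eqP xe; move: e0; rewrite -xe xin.
Qed.

Lemma newlos_notin n evs e :
  e \notin ins evs -> [seq p.2 | p <- newlos n evs & p.1 == Some e] = [::].
Proof.
elim: evs n => //= ev evs IH n; rewrite mem_cat => /norP[e0 /IH].
rewrite filter_cat map_cat => ->; rewrite cats0 filter_map -map_comp.
rewrite (@eq_in_filter _ _ pred0) ?filter_pred0 // => x /= xin.
by apply/negP => /eqP[xe]; move: e0; rewrite -xe xin.
Qed.

Lemma size_newups n evs : size (newups n evs) = size (outs evs).
Proof. by elim: evs n => //= ev evs IH n; rewrite !size_cat size_nseq IH. Qed.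

Lemma ainst_atoms (r : arule) us ls (a b : form E) :
  ainst r us ls a b -> atoms a = us /\ atoms b = ls.
Proof. by case. Qed.

(** Conservation of edges: structural steps permute the occurrences, and an event trades its inputs
    for its outputs. Uniqueness of the created names thus passes to the consumed ones, and a
    consumed edge must have been created. *)
Lemma trace_balance (A : eqType) (bar : A -> A) (lam : E -> A) F evs G :
  trace bar lam F evs G -> perm_eq (atoms F ++ outs evs) (ins evs ++ atoms G).
Proof.
elim=> {F evs G} [F|xi r a b evs G ab _ IH|xi r v us ls x a b evs G ab _ _ IH] /=.
- by rewrite cats0.
- apply: perm_trans IH; rewrite perm_cat2r.
  rewrite (permPl (atoms_plug _ _)) perm_sym (permPl (atoms_plug _ _)).
  by rewrite perm_cat2r perm_sym (atoms_sapply ab).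
have [<- <-] := ainst_atoms ab.
apply: (@perm_trans _ (atoms a ++ atoms (plug xi b) ++ outs evs)).
  have Pa := atoms_plug xi a; have Pb := atoms_plug xi b.
  rewrite (permPl (perm_cat Pa (perm_refl _))) -!catA perm_cat2l perm_sym.
  rewrite (permPl (perm_cat Pb (perm_refl _))) -!catA.
  by rewrite perm_catCA.
by rewrite -catA perm_cat2l.
Qed.

Lemma lab_form_fmap (A : Type) (lam : E -> A) (g : nat -> option E) n F :
  map g (iota n (size (atoms F))) = map Some (atoms F) ->
  (lab_form n (fmap lam F)).2 = n + size (atoms F) /\
  fmap g (lab_form n (fmap lam F)).1 = fmap Some F.
Proof.
elim: F n => [n|n|x n [gx]|a IHa b IHb n|a IHa b IHb n] /=; rewrite ?addn0 ?addn1 ?gx //.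
all: rewrite size_cat iotaD !map_cat => /eqP.
all: rewrite eqseq_cat ?size_map ?size_iota // => /andP[/eqP/IHa[n1 f1] /eqP/IHb].
all: case: lab_form n1 f1 => /= a' _ -> f1.
all: by case: lab_form => /= b' _ [-> f2]; rewrite addnA f1 f2.
Qed.

End Bookkeeping.

Section FlowOfTrace.
Variables (A : eqType) (bar : A -> A) (E V : eqType) (lam : E -> A).
Variables (F G : form E) (evs : seq (event E V)) (Psi : seq (step A)).
Hypotheses (tr : trace bar lam F evs G) (run : runs Psi F evs G).
(** This is the order of creation, so [index e S] is the number that the builder gives to [e], and
    [onth S] decodes it. *)
Let S := atoms F ++ outs evs.
Variables (st : bstate) (n : nat).
Hypothesis stE : flow_state (fmap lam F) Psi = (st, n).

Let facts : n = size (atoms F) /\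
  [/\ fmap (onth S) (bcur st) = fmap Some G,
      bvl st = labs evs,
      bups st = nseq n None ++ newups 0 evs
    & map (fun p => (onth S p.1, p.2)) (blos st) = newlos 0 evs].
Proof.
move: stE; rewrite /flow_state.
have := @lab_form_fmap _ _ lam (onth S) 0 F; rewrite map_onth.
case: lab_form => L m /= [//|->]; rewrite add0n => HL [<- <-]; split=> //.
have [//||H1 H2 H3 [los H4 H5]] :=
  run (g := onth S) (s := BSt L [::] (nseq (size (atoms F)) None) [::]).
  by rewrite size_nseq map_onth_cat.
by split=> //; rewrite H4.
Qed.

Lemma flow_of_top_size : n = size (atoms F). Proof. by have [] := facts. Qed.

Lemma flow_of_bvl : bvl st = labs evs. Proof. by have [_ []] := facts. Qed.

Lemma flow_of_size_bups : size (bups st) = size S.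
Proof.
by have [-> [_ _ -> _]] := facts; rewrite !size_cat size_nseq size_newups.
Qed.

Hypotheses (uS : uniq S) (uV : uniq (vtxs evs)).

Lemma flow_of_cur : atoms (bcur st) = map (index^~ S) (atoms G).
Proof.
have [_ [H _ _ _]] := facts.
have {H}: map (onth S) (atoms (bcur st)) = map Some (atoms G).
  by rewrite -!atoms_fmap H.
elim: (atoms _) (atoms _) => [|i s IH] [|e t] //= [ie /IH->].
by rewrite (onth_uniq uS ie).
Qed.

Lemma flow_of_up_top e : e \in atoms F -> nth None (bups st) (index e S) = None.
Proof.
have [-> [_ _ -> _]] := facts => eF.
by rewrite nth_cat size_nseq index_cat eF index_mem eF nth_nseq if_same.
Qed.

Lemma flow_of_up ev e : ev \in evs -> e \in ev_out ev ->
  nth None (bups st) (index e S) = Some (index (ev_vtx ev) (vtxs evs)).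
Proof.
move=> evin eout; have [-> [_ _ -> _]] := facts.
have eo : e \in outs evs by apply/flatten_mapP; exists ev.
move: uS; rewrite cat_uniq => /and3P[_ dis uo].
have /negPf eF : e \notin atoms F.
  by apply: contra dis => eF; apply/hasP; exists e.
rewrite nth_cat size_nseq index_cat eF ltnNge leq_addr /= addKn.
by rewrite (nth_newups 0 uV uo evin eout).
Qed.

Let los_of e : e \in S ->
  [seq p.2 | p <- blos st & p.1 == index e S] =
  [seq p.2 | p <- newlos 0 evs & p.1 == Some e].
Proof.
move=> eS; have [_ [_ _ _ <-]] := facts.
rewrite filter_map -map_comp; congr map; apply: eq_filter => p /=.
apply/eqP/eqP => [->|]; [exact: onth_index | exact: onth_uniq].
Qed.

Let uBal : uniq (ins evs ++ atoms G).
Proof. by rewrite -(perm_uniq (trace_balance tr)). Qed.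

Let memBal e : (e \in S) = (e \in ins evs) || (e \in atoms G).
Proof. by rewrite (perm_mem (trace_balance tr)) mem_cat. Qed.

Lemma flow_of_lo ev e : ev \in evs -> e \in ev_in ev ->
  ohead [seq p.2 | p <- blos st & p.1 == index e S] =
    Some (index (ev_vtx ev) (vtxs evs)).
Proof.
move=> evin ein; have eo : e \in ins evs by apply/flatten_mapP; exists ev.
move: uBal; rewrite cat_uniq => /and3P[ui _ _].
by rewrite los_of ?memBal ?eo // (newlos_in 0 uV ui evin ein).
Qed.

Lemma flow_of_lo_bot e : e \in atoms G ->
  ohead [seq p.2 | p <- blos st & p.1 == index e S] = None.
Proof.
move=> eG; rewrite los_of ?memBal ?eG ?orbT // newlos_notin //.
by move: uBal; rewrite cat_uniq => /and3P[_ /hasPn/(_ e eG)].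
Qed.

End FlowOfTrace.

(* [g] and [w] name the edges and vertices of the flow [C] in the trace; letting
   them be injections instead of identities allows a trace to be reused, with its
   old names, for a flow obtained by deleting edges and vertices. *)
Record traced (A : eqType) (bar : A -> A) (C : flow) (E V : eqType)
    (g : fE C -> E) (w : fV C -> V) (lam : E -> A)
    (F : form E) (evs : seq (event E V)) (G : form E) : Prop := Traced {
  traced_trace : trace bar lam F evs G;
  traced_top : atoms F = map g (ftop C);
  traced_bot : atoms G = map g (fbot C);
  traced_vtx : perm_eq (vtxs evs) (map w (enum (fV C)));
  traced_edge : perm_eq (atoms F ++ outs evs) (map g (enum (fE C)));
  traced_lab : forall ev v, ev \in evs -> ev_vtx ev = w v -> flab v = vlab_of (er ev);
  traced_up : forall ev v e, ev \in evs -> ev_vtx ev = w v -> g e \in ev_out ev ->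
    fup e = Some v;
  traced_lo : forall ev v e, ev \in evs -> ev_vtx ev = w v -> g e \in ev_in ev ->
    flo e = Some v;
  traced_up_top : forall e, e \in ftop C -> fup e = None;
  traced_lo_bot : forall e, e \in fbot C -> flo e = None }.

(** * Translation between flows and traces *)

Section Traced.
Variables (A : eqType) (bar : A -> A).

Lemma bij_flow_iso (B C : flow) (fv : fV B -> fV C) (fe : fE B -> fE C) :
  bijective fv -> bijective fe ->
  (forall v, flab (fv v) = flab v) ->
  (forall e, fup (fe e) = omap fv (fup e)) ->
  (forall e, flo (fe e) = omap fv (flo e)) ->
  ftop C = map fe (ftop B) -> fbot C = map fe (fbot B) ->
  flow_iso C B.
Proof.
move=> [fv' fvK fv'K] [fe' feK fe'K] lab up lo top bot; exists fv', fe'.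
have omK (o : option (fV B)) : o = omap fv' (omap fv o).
  by case: o => //= v; rewrite fvK.
split; split.
- by exists fv.
- by exists fe.
- by move=> v; rewrite -{2}(fv'K v) lab.
- by move=> e; rewrite -{2}(fe'K e) up -omK.
- by move=> e; rewrite -{2}(fe'K e) lo -omK.
- by rewrite top -map_comp map_id_in // => e _ /=; rewrite feK.
- by rewrite bot -map_comp map_id_in // => e _ /=; rewrite feK.
Qed.

(** An edge goes to the position of its name among the created names, a vertex to the position of
    its event. These are the builder's own numbers; injectivity of [g] and [w] and the two
    permutations in [traced] make both maps bijective. *)
Lemma traced_flow (C : flow) (E V : eqType) (g : fE C -> E) (w : fV C -> V)
    (lam : E -> A) F evs G :
  injective g -> injective w -> traced bar g w lam F evs G ->
  exists Psi, derivation bar (fmap lam F) Psi (fmap lam G) /\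
    flow_iso (flow_of (fmap lam F) Psi) C.
Proof.
move=> gI wI [tr top bot vtx edge lab up lo uptop lobot].
have [Psi der run] := trace_runs tr; exists Psi; split=> //.
rewrite /flow_of; case stE: flow_state => [st n].
have nE := flow_of_top_size run stE; have sb := flow_of_size_bups run stE.
have bvlE := flow_of_bvl run stE.
set S := atoms F ++ outs evs in edge sb.
have uS : uniq S by rewrite (perm_uniq edge) map_inj_uniq ?enum_uniq.
have uV : uniq (vtxs evs) by rewrite (perm_uniq vtx) map_inj_uniq ?enum_uniq.
have gS e : g e \in S by rewrite (perm_mem edge) map_f ?mem_enum.
have wV v : w v \in vtxs evs by rewrite (perm_mem vtx) map_f ?mem_enum.
have Vw ev : ev \in evs -> exists v, ev_vtx ev = w v.
  move=> evin; have : ev_vtx ev \in map w (enum (fV C)).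
    by rewrite -(perm_mem vtx) map_f.
  by case/mapP=> v _ ->; exists v.
have fe_lt e : index (g e) S < size (bups st) by rewrite sb index_mem.
have fv_lt v : index (w v) (vtxs evs) < size (bvl st).
  by rewrite bvlE size_map -(size_map (@ev_vtx _ _)) index_mem.
pose fe e : 'I_(size (bups st)) := Ordinal (fe_lt e).
pose fv v : 'I_(size (bvl st)) := Ordinal (fv_lt v).
have feI : injective fe.
  move=> e e' [H]; apply: gI; rewrite -(nth_index (g e) (gS e)) H nth_index //.
have fvI : injective fv.
  move=> v v' [H]; apply: wI; rewrite -(nth_index (w v) (wV v)) H nth_index //.
have insub_fv v : insub (index (w v) (vtxs evs)) = Some (fv v).
  exact: (valK (fv v)).
have valfe s : map val (map fe s) = map (index^~ S) (map g s).
  by rewrite -!map_comp.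
set D := (D in flow_iso D _); apply: (@bij_flow_iso C D fv fe).
- apply: inj_card_bij => //; rewrite card_ord bvlE size_map.
  by rewrite -(size_map (@ev_vtx _ _)) (perm_size vtx) size_map cardE.
- apply: inj_card_bij => //; rewrite card_ord sb.
  by rewrite (perm_size edge) size_map cardE.
- move=> v /=; have /mapP[ev evin evE] := wV v.
  by rewrite (lab _ _ evin (esym evE)) evE bvlE nth_labs.
- move=> e /=; have := gS e; rewrite mem_cat => /orP[ge|/flatten_mapP[ev evin ge]].
    rewrite (flow_of_up_top run stE ge) uptop //.
    by move: ge; rewrite top mem_map.
  rewrite (flow_of_up run stE uS uV evin ge) /=.
  by have [v vE] := Vw _ evin; rewrite (up _ _ _ evin vE ge) vE insub_fv.
- move=> e /=; have := gS e; rewrite (perm_mem (trace_balance tr)) mem_cat.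
  case/orP=> [/flatten_mapP[ev evin ge]|ge].
    rewrite (flow_of_lo tr run stE uS uV evin ge) /=.
    by have [v vE] := Vw _ evin; rewrite (lo _ _ _ evin vE ge) vE insub_fv.
  rewrite (flow_of_lo_bot tr run stE uS ge) lobot //.
  by move: ge; rewrite bot mem_map.
- apply: (inj_map val_inj); rewrite valfe -top map_index_cat; last first.
    by move: uS; rewrite cat_uniq => /andP[].
  rewrite -nE [LHS](pmap_filter (@insubK _ _ _)).
  apply/all_filterP/allP => i; rewrite mem_iota nE => /andP[_ lti].
  by rewrite insubT //= sb size_cat ltn_addr.
- apply: (inj_map val_inj); rewrite valfe -bot -(flow_of_cur run stE uS).
  rewrite [LHS](pmap_filter (@insubK _ _ _)).
  apply/all_filterP/allP => i; rewrite (flow_of_cur run stE uS) bot.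
  by case/mapP=> _ /mapP[e _ ->] ->; rewrite (valK (fe e)).
Qed.

(** An edge is an occurrence of some atom. The atom serves as the default of [nth] when labels are
    read from a list. *)
Lemma flow_edge_inhabited (B : flow) P Phi Q (e : fE B) :
  derivation bar P Phi Q -> flow_iso (flow_of P Phi) B -> inhabited A.
Proof.
move=> /derivation_trace[L [k tr]]; rewrite /flow_of.
case stE: flow_state => [st n] [_ [fe [[_ [fe' _ _] _] _]]].
have PE : fmap id P = P := subst_At P.
have [|evs [G [_ run _ outsE _]]] := tr A unit id P L (nseq k tt) PE (map_id L).
  by rewrite size_nseq.
rewrite -{1}PE in stE; have := ltn_ord (fe' e).
rewrite [X in _ < X](flow_of_size_bups run stE).
by case: (_ ++ _) => // a.
Qed.

(** The isomorphism lists the edges of [B] in the order of their numbers. The first [n] of them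
    relabel the premiss, the others name the created occurrences, and the atom of an edge is found
    at its number in [atoms P ++ L]. *)
Lemma flow_traced (B : flow) P Phi Q (a0 : A) :
  derivation bar P Phi Q -> flow_iso (flow_of P Phi) B ->
  exists (lam : fE B -> A) F (evs : seq (event (fE B) (fV B))) G,
    [/\ fmap lam F = P, fmap lam G = Q & traced bar id id lam F evs G].
Proof.
move=> /derivation_trace[L [k tr]]; rewrite /flow_of.
case stE: flow_state => [st n] [fv [fe [[bfv bfe lab] [up lo top bot]]]].
move: fv fe bfv bfe lab up lo top bot => /=.
move=> fv fe [fv' fvK fv'K] [fe' feK fe'K] lab up lo top bot.
have PE : fmap id P = P := subst_At P.
(* In this provisional run each occurrence is named by its own atom and all vertices are [tt]; only
   the resulting sizes matter. *)
have [|evs0 [G0 [_ run0 _ outs0 vtx0]]] := tr A unit id P L (nseq k tt) PE (map_id L).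
  by rewrite size_nseq.
have [nE sb] : n = size (atoms P) /\ size (bups st) = size (atoms P ++ L).
  have stE0 : flow_state (fmap id P) Phi = (st, n) by rewrite PE.
  by rewrite (flow_of_top_size run0 stE0) (flow_of_size_bups run0 stE0) outs0.
have sv : size (bvl st) = k.
  have stE0 : flow_state (fmap id P) Phi = (st, n) by rewrite PE.
  by rewrite (flow_of_bvl run0 stE0) size_map -(size_map (@ev_vtx _ _)) vtx0 size_nseq.
pose S := map fe (enum 'I_(size (bups st))).
pose lam e := nth a0 (atoms P ++ L) (fe' e).
have lamS : map lam S = atoms P ++ L.
  rewrite -map_comp (eq_map (g := nth a0 (atoms P ++ L) \o val)).
    by rewrite map_comp val_enum_ord sb map_nth_iota0 // take_size.
  by move=> i /=; rewrite /lam feK.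
have sS : size S = size (atoms P ++ L) by rewrite size_map size_enum_ord.
have [|F shF atF] := @form_relabel _ _ P (take n S).
  by rewrite size_takel nE // sS size_cat leq_addr.
have FP : fmap lam F = P.
  apply: form_ext; first by rewrite subst_comp.
  by rewrite atoms_fmap atF map_take lamS nE take_size_cat.
have DL : map lam (drop n S) = L by rewrite map_drop lamS nE drop_size_cat.
have [|evs [G [tr1 run GQ outsE vtxE]]] :=
    tr _ _ lam F (drop n S) (map fv (enum 'I_(size (bvl st)))) FP DL.
  by rewrite size_map size_enum_ord.
have SE : atoms F ++ outs evs = S by rewrite atF outsE cat_take_drop.
have uS : uniq (atoms F ++ outs evs).
  by rewrite SE map_inj_uniq ?enum_uniq //; apply: can_inj feK.
have uV : uniq (vtxs evs).
  by rewrite vtxE map_inj_uniq ?enum_uniq //; apply: can_inj fvK.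
have idxE e : index e S = fe' e :> nat.
  by rewrite -{1}(fe'K e) (index_map (can_inj feK)) index_enum_ord.
have idxV v : index v (vtxs evs) = fv' v :> nat.
  by rewrite vtxE -{1}(fv'K v) (index_map (can_inj fvK)) index_enum_ord.
rewrite -FP in stE.
have bvlE := flow_of_bvl run stE.
have topE : atoms F = ftop B.
  rewrite atF top -map_take; congr map; apply: (inj_map val_inj).
  rewrite map_take val_enum_ord take_iota [RHS](pmap_filter (@insubK _ _ _)).
  have /minn_idPl-> : n <= size (bups st) by rewrite nE sb size_cat leq_addr.
  apply/esym/all_filterP/allP => i; rewrite mem_iota => /andP[_ lti].
  by rewrite insubT //= sb size_cat ltn_addr // -nE.
have botE : atoms G = fbot B.
  rewrite bot (flow_of_cur run stE uS) SE.
  by elim: (atoms G) => //= e s IH; rewrite idxE valK /= fe'K -IH.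
exists lam, F, evs, G; split=> //; split; rewrite ?map_id //.
- rewrite vtxE; apply: uniq_perm; rewrite ?enum_uniq -?vtxE // => v.
  by rewrite mem_enum vtxE -(fv'K v) map_f ?mem_enum.
- apply: uniq_perm; rewrite ?enum_uniq // => e.
  by rewrite mem_enum SE -(fe'K e) map_f ?mem_enum.
- move=> ev v evin vE.
  by rewrite -{1}(fv'K v) lab -idxV -vE bvlE nth_labs.
- move=> ev v e evin vE ein; rewrite -(fe'K e) up -idxE -SE.
  by rewrite (flow_of_up run stE uS uV evin ein) /= idxV vE valK /= fv'K.
- move=> ev v e evin vE ein; rewrite -(fe'K e) lo /= -idxE -SE.
  by rewrite (flow_of_lo tr1 run stE uS uV evin ein) /= idxV vE valK /= fv'K.
- move=> e; rewrite -topE => et; rewrite -(fe'K e) up -idxE -SE.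
  by rewrite (flow_of_up_top run stE et).
- move=> e; rewrite -botE => eb; rewrite -(fe'K e) lo /= -idxE -SE.
  by rewrite (flow_of_lo_bot tr1 run stE uS eb).
Qed.

End Traced.

(** * Composing traces and moving a formula through a context *)

Section TraceCalculus.
Variables (A : eqType) (bar : A -> A) (E : eqType) (lam : E -> A) (V : eqType).
Implicit Types (F G H a b : form E) (evs : seq (event E V)).
Local Notation trace := (@trace A bar E lam V).
Local Notation "F ~> G" := (trace F [::] G) (at level 70).

Lemma trace_cat G F H (evs1 evs2 : seq (event E V)) :
  trace F evs1 G -> trace G evs2 H -> trace F (evs1 ++ evs2) H.
Proof.
elim=> {F evs1 G} [F|xi r a b evs G ab _ IH|xi r v us ls x a b evs G ab lab _ IH] //=.
- by move=> /IH; exact: tr_str ab.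
- by move=> /IH; exact: tr_ev ab lab.
Qed.

Lemma trace_trans G F H evs : F ~> G -> trace G evs H -> trace F evs H.
Proof. exact: trace_cat. Qed.

Lemma trace_transr G F H evs : trace F evs G -> G ~> H -> trace F evs H.
Proof. by rewrite -{2}(cats0 evs); apply: trace_cat. Qed.

Lemma trace_plug xi F evs G : trace F evs G -> trace (plug xi F) evs (plug xi G).
Proof.
elim=> {F evs G} [F|c r a b evs G ab _ IH|c r v us ls x a b evs G ab lab _ IH].
- exact: tr_nil.
- by rewrite -plug_ccomp; apply: tr_str ab _; rewrite plug_ccomp.
- by rewrite -!plug_ccomp; apply: tr_ev ab lab _; rewrite plug_ccomp.
Qed.

Lemma trace_sapply r a b : sapply r a = Some b -> a ~> b.
Proof. by move=> ab; apply: (tr_str (xi := Hole) ab); apply: tr_nil. Qed.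

Lemma trace_event r v us ls x a b :
  ainst r us ls a b -> rinst bar (RA r x) (fmap lam a) (fmap lam b) ->
  trace a [:: Ev r v us ls] b.
Proof. by move=> ab lab; apply: (tr_ev (xi := Hole) v ab lab); apply: tr_nil. Qed.

Lemma trace_or a b c d (evs1 evs2 : seq (event E V)) :
  trace a evs1 c -> trace b evs2 d -> trace (FOr a b) (evs1 ++ evs2) (FOr c d).
Proof.
move=> /(trace_plug (COrL Hole b)) ac /(trace_plug (COrR c Hole)).
exact: trace_cat ac.
Qed.

Lemma trace_and a b c d (evs1 evs2 : seq (event E V)) :
  trace a evs1 c -> trace b evs2 d -> trace (FAnd a b) (evs1 ++ evs2) (FAnd c d).
Proof.
move=> /(trace_plug (CAndL Hole b)) ac /(trace_plug (CAndR c Hole)).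
exact: trace_cat ac.
Qed.

Lemma trace_orC a b : FOr a b ~> FOr b a.
Proof. exact: (@trace_sapply SCommOr). Qed.

Lemma trace_andC a b : FAnd a b ~> FAnd b a.
Proof. exact: (@trace_sapply SCommAnd). Qed.

Lemma trace_orA a b c : FOr (FOr a b) c ~> FOr a (FOr b c).
Proof. exact: (@trace_sapply SAssocOrI). Qed.

Lemma trace_andA a b c : FAnd (FAnd a b) c ~> FAnd a (FAnd b c).
Proof. exact: (@trace_sapply SAssocAndI). Qed.

Lemma trace_switch a b c : FAnd a (FOr b c) ~> FOr (FAnd a b) c.
Proof. exact: (@trace_sapply SSwitch). Qed.

(** The disjunct leaves a surrounding disjunction by associativity and a surrounding conjunction by
    one switch. *)
Lemma trace_plug_or xi a b : plug xi (FOr a b) ~> FOr (plug xi a) b.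
Proof.
have refl F : F ~> F by apply: tr_nil.
elim: xi => [|xi IH f|f xi IH|xi IH f|f xi IH] //=.
- apply: trace_trans (trace_or IH (refl f)) _; apply: trace_trans (trace_orA _ _ _) _.
  apply: trace_trans (trace_or (refl _) (trace_orC _ _)) _.
  exact: (@trace_sapply SAssocOr).
- by apply: trace_trans (trace_or (refl f) IH) _; apply: (@trace_sapply SAssocOr).
- apply: trace_trans (trace_and IH (refl f)) _; apply: trace_trans (trace_andC _ _) _.
  apply: trace_trans (trace_switch _ _ _) _.
  exact: (trace_or (trace_andC _ _) (refl b)).
- apply: trace_trans (trace_and (refl f) IH) _; exact: trace_switch.
Qed.

(** Dual to [trace_plug_or]: the conjunct enters a conjunction by associativity and a disjunction by
    one switch. *)
Lemma trace_and_plug xi a b : FAnd (plug xi a) b ~> plug xi (FAnd a b).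
Proof.
have refl F : F ~> F by apply: tr_nil.
elim: xi => [|xi IH f|f xi IH|xi IH f|f xi IH] //=.
- apply: trace_trans (trace_andC _ _) _; apply: trace_trans (trace_switch _ _ _) _.
  apply: (trace_plug (COrL Hole f)); exact: trace_trans (trace_andC _ _) IH.
- apply: trace_trans (trace_andC _ _) _.
  apply: trace_trans (trace_and (refl b) (trace_orC _ _)) _.
  apply: trace_trans (trace_switch _ _ _) _; apply: trace_trans (trace_orC _ _) _.
  apply: (trace_plug (COrR f Hole)); exact: trace_trans (trace_andC _ _) IH.
- apply: trace_trans (trace_andA _ _ _) _.
  apply: trace_trans (trace_and (refl _) (trace_andC _ _)) _.
  apply: (@trace_trans (FAnd (FAnd (plug xi a) b) f)).
    exact: (@trace_sapply SAssocAnd).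
  exact: (trace_and IH (refl f)).
- apply: trace_trans (trace_andA _ _ _) _; exact: (trace_and (refl f) IH).
Qed.

Lemma trace_cat_inv F (evs1 evs2 : seq (event E V)) G :
  trace F (evs1 ++ evs2) G -> exists2 H, trace F evs1 H & trace H evs2 G.
Proof.
move Ee: (evs1 ++ evs2) => evs tr; elim: tr evs1 Ee => {F evs G}
  [F|xi r a b evs G ab tr IH|xi r v us ls x a b evs G ab lab tr IH] evs1.
- by case: evs1 evs2 => [|//] [|//] _; exists F; apply: tr_nil.
- by move=> /IH[H trH HG]; exists H => //; apply: tr_str ab trH.
- case: evs1 => [/= ->|ev evs1 [-> /IH[H trH HG]]].
    by exists (plug xi a); [apply: tr_nil | apply: tr_ev lab tr].
  by exists H => //; apply: tr_ev lab trH.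
Qed.

Lemma trace_cons_inv F ev evs G :
  trace F (ev :: evs) G ->
  exists xi a b x,
    [/\ F ~> plug xi a, ainst (er ev) (ev_in ev) (ev_out ev) a b,
        rinst bar (RA (er ev) x) (fmap lam a) (fmap lam b)
      & trace (plug xi b) evs G].
Proof.
move Ee: (ev :: evs) => evs' tr; elim: tr Ee => {F evs' G}
  [F|xi r a b evs' G ab tr IH|xi r v us ls x a b evs' G ab lab tr _] //.
- move=> /IH[c [a' [b' [x [H1 H2 H3 H4]]]]].
  by exists c, a', b', x; split=> //; apply: tr_str ab H1.
- by move=> [-> ->]; exists xi, a, b, x; split=> //; apply: tr_nil.
Qed.

(* Only edges that no event touches are affected, so the events are unchanged. *)
Lemma trace_subst (s : E -> form E) F evs G :
  trace F evs G -> {in ins evs ++ outs evs, s =1 (fun e => At e)} ->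
  trace (subst s F) evs (subst s G).
Proof.
elim=> {F evs G} [F _|xi r a b evs G ab _ IH sE|xi r v us ls x a b evs G ab lab _ IH sE].
- exact: tr_nil.
- rewrite subst_plug; apply: tr_str (sapply_subst s ab) _.
  by rewrite -subst_plug; apply: IH.
have [Ea Eb] := ainst_atoms ab.
have sid c : {subset atoms c <= us ++ ls} -> subst s c = c.
  move=> cs; rewrite -{2}(subst_At c); apply: eq_in_subst => e /cs.
  rewrite mem_cat => e_in; apply: sE; rewrite /= !mem_cat.
  by case/orP: e_in => ->; rewrite ?orbT.
rewrite subst_plug sid; last by move=> e; rewrite Ea mem_cat => ->.
apply: tr_ev ab lab _; rewrite -[b]sid; last first.
  by move=> e; rewrite Eb mem_cat => ->; rewrite orbT.
rewrite -subst_plug; apply: IH => e; rewrite mem_cat => e_in; apply: sE.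
by rewrite /= !mem_cat; case/orP: e_in => ->; rewrite ?orbT.
Qed.

End TraceCalculus.

Definition emap E E' V V' (f : E -> E') (w : V -> V') (ev : event E V) : event E' V' :=
  Ev (er ev) (w (ev_vtx ev)) (map f (ev_in ev)) (map f (ev_out ev)).

Lemma ainst_map (E E' : Type) (f : E -> E') r us ls a b :
  ainst r us ls a b -> ainst r (map f us) (map f ls) (fmap f a) (fmap f b).
Proof. by case=> *; constructor. Qed.

Lemma trace_map (A E E' : eqType) (V V' : Type) (bar : A -> A) (lam : E -> A)
    (lam' : E' -> A) (f : E -> E') (w : V -> V') F evs G :
  lam' \o f =1 lam -> trace bar lam F evs G ->
  trace bar lam' (fmap f F) (map (emap f w) evs) (fmap f G).
Proof.
move=> lamE; elim=> {F evs G}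
  [F|xi r a b evs G ab _ IH|xi r v us ls x a b evs G ab lab _ IH] /=.
- exact: tr_nil.
- rewrite subst_plug; apply: tr_str (sapply_subst _ ab) _.
  by rewrite -subst_plug.
- have lE c : fmap lam' (fmap f c) = fmap lam c.
    by rewrite subst_comp; apply: eq_in_subst => e _ /=; rewrite -lamE.
  rewrite subst_plug; apply: (tr_ev (x := x) _ (ainst_map f ab)).
    by rewrite !lE.
  by rewrite -subst_plug.
Qed.

(** * Splitting a trace at a simple edge *)

Section SplitTrace.
Variables (A : eqType) (bar : A -> A) (E : eqType) (lam : E -> A) (V : eqType).
Hypothesis barK : involutive bar.

Lemma mem_split (T : eqType) (x : T) s : x \in s -> exists s1 s2, s = s1 ++ x :: s2.
Proof. by case/splitPr=> s1 s2; exists s1, s2. Qed.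

Lemma flatten_map_split (T U : Type) (f : T -> seq U) s1 x s2 y s3 :
  flatten (map f (s1 ++ x :: s2 ++ y :: s3)) =
    flatten (map f s1) ++ f x ++ flatten (map f s2) ++ f y ++ flatten (map f s3).
Proof. by rewrite map_cat flatten_cat /= map_cat flatten_cat. Qed.

Lemma ainst_intP us ls (a b : form E) e :
  ainst AInt us ls a b -> e \in ls ->
  exists e', [/\ us = [::], perm_eq ls [:: e; e'], a = TT &
    b = FOr (At e) (At e') \/ b = FOr (At e') (At e)].
Proof.
move Er: AInt => r ab; case: ab Er => // e1 e2 _; rewrite !inE.
case/orP=> /eqP->; first by exists e2; split=> //; left.
by exists e1; split=> //; [apply/permP=> p /=; rewrite addnCA | right].
Qed.

Lemma ainst_cutP us ls (a b : form E) e :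
  ainst ACutR us ls a b -> e \in us ->
  exists e', [/\ perm_eq us [:: e; e'], ls = [::], b = FF &
    a = FAnd (At e) (At e') \/ a = FAnd (At e') (At e)].
Proof.
move Er: ACutR => r ab; case: ab Er => // e1 e2 _; rewrite !inE.
case/orP=> /eqP->; first by exists e2; split=> //; left.
by exists e1; split=> //; [apply/permP=> p /=; rewrite addnCA | right].
Qed.

(* The edge [eps] is replaced by the unit [t] (resp. [f]) all along its way from
   the interaction to the cut. Then [EI] only has to create its other lower edge
   [eps2], or to receive it from a new premiss, and [EC] to send its other upper
   edge [eps3] to a new conclusion, or to destroy it. *)
Lemma split_trace F (evs : seq (event E V)) G EI EC eps :
  trace bar lam F evs G -> uniq (atoms F ++ outs evs) ->
  EI \in evs -> EC \in evs -> er EI = AInt -> er EC = ACutR ->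
  eps \in ev_out EI -> eps \in ev_in EC ->
  exists evs1 evs2 evs3 eps2 eps3,
    [/\ evs = evs1 ++ EI :: evs2 ++ EC :: evs3,
        [/\ ev_in EI = [::], perm_eq (ev_out EI) [:: eps; eps2] & eps2 != eps],
        [/\ ev_out EC = [::], perm_eq (ev_in EC) [:: eps; eps3] & eps3 != eps],
        lam eps2 = lam eps3
      & trace bar lam F
          (evs1 ++ Ev AWeak (ev_vtx EI) [::] [:: eps2] :: evs2 ++ evs3)
          (FOr G (At eps3)) /\
        trace bar lam (FAnd F (At eps2))
          (evs1 ++ evs2 ++ Ev ACoweak (ev_vtx EC) [:: eps3] [::] :: evs3) G].
Proof.
move=> tr uS EIin ECin rEI rEC epsI epsC.
have uB : uniq (ins evs ++ atoms G) by rewrite -(perm_uniq (trace_balance tr)).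
have [X [evs3 evsE]] := mem_split ECin.
move: tr uS uB EIin; rewrite {}evsE => tr uS uB EIin.
have [H trX /trace_cons_inv[zeta [a [b [y [HZ abC labC trZ]]]]]] := trace_cat_inv tr.
have {}trX := trace_transr trX HZ.
rewrite rEC in abC labC; have [eps3 [inEC outEC bE aE]] := ainst_cutP abC epsC.
(* The interaction comes before the cut: just before [EC] the edge is present, so by balance it is
   already created. If [EI] came later, it would create the edge a second time. *)
have EIX : EI \in X.
  have epsX : eps \in atoms F ++ outs X.
    rewrite (perm_mem (trace_balance trX)) mem_cat (perm_mem (atoms_plug _ _)) mem_cat.
    by rewrite (ainst_atoms abC).1 epsC orbT.
  move: EIin; rewrite mem_cat inE => /orP[//|/orP[/eqP EIC|EI3]].
    by rewrite EIC rEC in rEI.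
  move: uS; rewrite map_cat flatten_cat catA cat_uniq => /and3P[_ /hasPn/(_ eps) + _].
  rewrite epsX => H'; exfalso; move: H'.
  rewrite /= outEC /=; suff -> : eps \in outs evs3 by move/(_ isT).
  by apply/flatten_mapP; exists EI.
have [evs1 [evs2 XE]] := mem_split EIX.
rewrite {}XE in trX uS uB *; rewrite -catA cat_cons in uS uB *.
have [H' tr1 /trace_cons_inv[xi [c [d [x [HX abI labI tr2]]]]]] := trace_cat_inv trX.
have {}tr1 := trace_transr tr1 HX.
rewrite rEI in abI labI; have [eps2 [inEI outEI cE dE]] := ainst_intP abI epsI.
exists evs1, evs2, evs3, eps2, eps3.
(* The edge is created at most once and consumed at most once, and [EI] and [EC] account for this.
   Hence no other event touches it, as [trace_subst] demands, and [eps2] and [eps3] differ from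
   it. *)
have cntS := count_uniq_mem eps uS; have cntB := count_uniq_mem eps uB.
rewrite flatten_map_split !count_cat in cntS; rewrite flatten_map_split !count_cat in cntB.
rewrite (permP outEI) outEC /= eqxx in cntS.
rewrite (permP inEC) inEI /= eqxx in cntB.
have [[F0 o1] [o2 o3] n02] :
    [/\ count_mem eps (atoms F) = 0 /\ count_mem eps (outs evs1) = 0,
        count_mem eps (outs evs2) = 0 /\ count_mem eps (outs evs3) = 0
      & eps2 != eps].
  move: (leq_trans (eq_leq cntS) (leq_b1 _)).
  by case: (_ == _); clear=> le1; split; try split; lia.
have [[G0 i1] [i2 i3] n03] :
    [/\ count_mem eps (atoms G) = 0 /\ count_mem eps (ins evs1) = 0,
        count_mem eps (ins evs2) = 0 /\ count_mem eps (ins evs3) = 0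
      & eps3 != eps].
  move: (leq_trans (eq_leq cntB) (leq_b1 _)).
  by case: (_ == _); clear=> le1; split; try split; lia.
have nF : eps \notin atoms F by apply/count_memPn.
have nG : eps \notin atoms G by apply/count_memPn.
have fresh (s : E -> form E) (evs' : seq (event E V)) : (forall e, e != eps -> s e = At e) ->
    count_mem eps (ins evs') = 0 -> count_mem eps (outs evs') = 0 ->
    {in ins evs' ++ outs evs', s =1 (fun e => At e)}.
  move=> sE i0 o0 e ein; apply: sE; apply: contraTneq ein => ->.
  by apply/count_memPn; rewrite count_cat i0 o0.
(* The edge may be either side of the interaction; when it carries the barred atom, [barK] gives the
   same value. With the cut treated alike, [eps2] and [eps3] get equal labels. *)
have lam2 : lam eps2 = bar (lam eps).
  case: labI => _; case: dE => -> [] -> // ->; by rewrite barK.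
have lam3 : lam eps3 = bar (lam eps).
  case: labC => + _; case: aE => -> [] -> // ->; by rewrite barK.
split=> //; first by rewrite lam2 lam3.
have sid (s : E -> form E) f : (forall e, e != eps -> s e = At e) ->
    eps \notin atoms f -> subst s f = f.
  move=> sE nf; rewrite -{2}(subst_At f); apply: eq_in_subst => e ef; apply: sE.
  by apply: contraNneq nf => <-.
pose EW := Ev AWeak (ev_vtx EI) [::] [:: eps2].
pose EK := Ev ACoweak (ev_vtx EC) [:: eps3] [::].
split.
(* With t for the edge, the interaction becomes t = [t \/ f], then a weakening to [t \/ eps2]. The
   premiss (t /\ eps3) of the cut equals [f \/ eps3]: the f stays as the conclusion of the cut, and
   [eps3] is pulled out. *)
- pose s e : form E := if e == eps then TT else At e.
  have sE e : e != eps -> s e = At e by rewrite /s => /negPf->.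
  have s0 : s eps = TT by rewrite /s eqxx.
  have := trace_subst tr1 (fresh s _ sE i1 o1); rewrite (sid _ _ sE nF) subst_plug cE /=.
  move=> {}tr1; apply: (trace_cat tr1).
  have tW : trace bar lam (plug (csubst s xi) TT) [:: EW] (subst s (plug xi d)).
    rewrite subst_plug; apply: trace_plug.
    apply: (@trace_trans _ _ _ _ _ (FOr TT FF)).
      exact: (@trace_sapply _ _ _ _ _ SUnitOrI).
    have tw : trace bar lam (FOr TT FF) [:: EW] (FOr TT (At eps2)).
      apply: (@trace_plug _ _ _ _ _ (COrR TT Hole)).
      by apply: (trace_event (x := lam eps2) _); first constructor.
    case: dE => -> /=; rewrite s0 (sE _ n02) //.
    exact: trace_transr tw (trace_orC _ _ _ _ _).
  apply: (trace_cat tW); apply: (trace_cat (trace_subst tr2 (fresh s _ sE i2 o2))).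
  have := trace_subst trZ (fresh s _ sE i3 o3); rewrite (sid _ _ sE nG) !subst_plug bE /=.
  move=> /(trace_plug (COrL Hole (At eps3))) /=; apply: trace_trans.
  apply: trace_trans (trace_plug_or _ _ _ _ _ _); apply: trace_plug.
  apply: (@trace_trans _ _ _ _ _ (At eps3)).
    case: aE => -> /=; rewrite s0 (sE _ n03).
      apply: trace_trans (trace_andC _ _ _ _ _) _.
      exact: (@trace_sapply _ _ _ _ _ SUnitAnd).
    exact: (@trace_sapply _ _ _ _ _ SUnitAnd).
  apply: trace_trans _ (trace_orC _ _ _ _ _).
  exact: (@trace_sapply _ _ _ _ _ SUnitOrI).
(* Dually, [eps2] is pushed from the premiss to the place of the interaction, where (t /\ eps2)
   equals [f \/ eps2]. The cut becomes a coweakening of [eps3] inside (f /\ eps3), followed by (f /\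
   t) = f. *)
- pose s e : form E := if e == eps then FF else At e.
  have sE e : e != eps -> s e = At e by rewrite /s => /negPf->.
  have s0 : s eps = FF by rewrite /s eqxx.
  have := trace_subst tr1 (fresh s _ sE i1 o1); rewrite (sid _ _ sE nF) subst_plug cE /=.
  move=> /(trace_plug (CAndL Hole (At eps2))) /= {}tr1; apply: (trace_cat tr1).
  have tI : trace bar lam (FAnd (plug (csubst s xi) TT) (At eps2)) ([::] : seq (event E V))
      (subst s (plug xi d)).
    apply: trace_trans (trace_and_plug _ _ _ _ _ _) _.
    rewrite subst_plug; apply: trace_plug; apply: trace_trans (trace_andC _ _ _ _ _) _.
    apply: (@trace_trans _ _ _ _ _ (At eps2)); first exact: (@trace_sapply _ _ _ _ _ SUnitAnd).
    have tw : trace bar lam (At eps2) ([::] : seq (event E V)) (FOr (At eps2) FF).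
      exact: (@trace_sapply _ _ _ _ _ SUnitOrI).
    case: dE => -> /=; rewrite s0 (sE _ n02) //.
    exact: trace_transr tw (trace_orC _ _ _ _ _).
  apply: (trace_trans tI); apply: (trace_cat (trace_subst tr2 (fresh s _ sE i2 o2))).
  have := trace_subst trZ (fresh s _ sE i3 o3); rewrite (sid _ _ sE nG) !subst_plug bE /=.
  apply: (@trace_cat _ _ _ _ _ _ _ _ [:: EK]); apply: trace_plug.
  have tk : trace bar lam (FAnd FF (At eps3)) [:: EK] (FAnd FF TT).
    apply: (@trace_plug _ _ _ _ _ (CAndR FF Hole)).
    by apply: (trace_event (x := lam eps3) _); first constructor.
  apply: (@trace_transr _ _ _ _ _ (FAnd FF TT)); last exact: (@trace_sapply _ _ _ _ _ SUnitAnd).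
  case: aE => -> /=; rewrite s0 (sE _ n03) //.
  by apply: trace_trans (trace_andC _ _ _ _ _) _.
Qed.
End SplitTrace.

Lemma perm_map_enum_del (T U : finType) (d : T) s (w : U -> T) :
  perm_eq (d :: s) (enum T) -> injective w ->
  (forall x, x != d <-> exists u, x = w u) -> perm_eq s (map w (enum U)).
Proof.
move=> ps wI wE; have := perm_uniq ps; rewrite enum_uniq /= => /andP[ds us].
apply: uniq_perm => [||x]; [by [] | by rewrite map_inj_uniq ?enum_uniq |].
have := perm_mem ps x; rewrite inE mem_enum; case: eqP => [-> _|/eqP xd /= ->].
  rewrite (negPf ds); apply/esym/negP => /mapP[u _ dE].
  by have /eqP := (wE d).2 (ex_intro _ u dE).
by have [u ->] := (wE x).1 xd; rewrite map_f ?mem_enum.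
Qed.

Section SplitTraced.
Variables (A : eqType) (bar : A -> A).
Hypothesis barK : involutive bar.

(** Both traces keep the names of [B]. The new weakening inherits the name of the interaction and
    the new coweakening that of the cut, so [wW] misses exactly the cut and [wK] exactly the
    interaction, while [val] misses exactly [eps]. *)
Lemma split_traced (B : flow) (eps : fE B) lam F (evs : seq (event (fE B) (fV B))) G :
  traced bar id id lam F evs G -> simple eps ->
  exists e2 e3 (wW : fV (splitW eps) -> fV B) (wK : fV (splitCW eps) -> fV B) evsW evsK,
    [/\ lam e2 = lam e3, injective wW, injective wK,
        @traced A bar (splitW eps) _ _ val wW lam F evsW (FOr G (At e3))
      & @traced A bar (splitCW eps) _ _ val wK lam (FAnd F (At e2)) evsK G].
Proof.
move=> [tr]; rewrite !map_id => top bot vtx edge lab up lo uptop lobot.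
rewrite /simple; case upE: fup => [iota|//]; case loE: flo => [kap|//] /andP[intI cutK].
have uS : uniq (atoms F ++ outs evs) by rewrite (perm_uniq edge) enum_uniq.
have uV : uniq (vtxs evs) by rewrite (perm_uniq vtx) enum_uniq.
have inS e : e \in atoms F ++ outs evs by rewrite (perm_mem edge) mem_enum.
have outev e v : fup e = Some v -> exists ev, [/\ ev \in evs, e \in ev_out ev & ev_vtx ev = v].
  move=> ev; have := inS e; rewrite mem_cat top => /orP[/uptop|/flatten_mapP[x xin ex]].
    by rewrite ev.
  by exists x; split=> //; have := up x _ e xin (erefl _) ex; rewrite ev => -[].
have inev e v : flo e = Some v -> exists ev, [/\ ev \in evs, e \in ev_in ev & ev_vtx ev = v].
  move=> ev; have := inS e; rewrite (perm_mem (trace_balance tr)) mem_cat bot.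
  case/orP=> [/flatten_mapP[x xin ex]|/lobot]; last by rewrite ev.
  by exists x; split=> //; have := lo x _ e xin (erefl _) ex; rewrite ev => -[].
have [EI [EIin epsI vI]] := outev _ _ upE; have [EC [ECin epsC vC]] := inev _ _ loE.
have rEI : er EI = AInt by move: intI; rewrite (lab _ _ EIin vI); case: (er EI).
have rEC : er EC = ACutR by move: cutK; rewrite (lab _ _ ECin vC); case: (er EC).
have [evs1 [evs2 [evs3 [e2 [e3 [evsE [inI outI n2] [outC inC n3] lam23 [trW trK]]]]]]] :=
  split_trace barK tr uS EIin ECin rEI rEC epsI epsC.
have vtxI := vtx_inj uV.
have e2I : e2 \in ev_out EI by rewrite (perm_mem outI) !inE eqxx orbT.
have e3C : e3 \in ev_in EC by rewrite (perm_mem inC) !inE eqxx orbT.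
have up2 : fup e2 = Some iota by apply: up EIin vI e2I.
have lo3 : flo e3 = Some kap by apply: lo ECin vC e3C.
(* The choice by [pick] has one candidate: an edge with upper end [iota] is an output of an event at
   [iota], hence of [EI], whose outputs are [eps] and [e2]. *)
have eps2E : eps2 eps = Some e2.
  rewrite /eps2; case: pickP => [e /andP[ne /eqP]|/(_ e2)]; last by rewrite n2 up2 upE eqxx.
  rewrite upE => /outev[ev [evin eev vev]].
  have evI : ev = EI by apply: vtxI => //; rewrite vev vI.
  by move: eev; rewrite evI (perm_mem outI) !inE (negPf ne) => /eqP->.
have eps3E : eps3 eps = Some e3.
  rewrite /eps3; case: pickP => [e /andP[ne /eqP]|/(_ e3)]; last by rewrite n3 lo3 loE eqxx.
  rewrite loE => /inev[ev [evin eev vev]].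
  have evC : ev = EC by apply: vtxI => //; rewrite vev vC.
  by move: eev; rewrite evC (perm_mem inC) !inE (negPf ne) => /eqP->.
have IK : iota != kap by apply: contraTneq intI => ->; move: cutK; case: flab.
pose old := evs1 ++ evs2 ++ evs3.
have oldE : perm_eq (iota :: kap :: vtxs old) (enum (fV B)).
  rewrite -(permPr vtx) evsE !map_cat /= !map_cat /= vI vC; apply/permP => p.
  by rewrite /= !count_cat /= !count_cat /=; clear; lia.
have oldP ev : ev \in old -> [/\ ev \in evs, ev_vtx ev != iota & ev_vtx ev != kap].
  move=> evin; have := perm_uniq oldE; rewrite enum_uniq /= inE.
  case/andP=> /norP[_ nI] /andP[nK _]; split.
  - by move: evin; rewrite evsE !(mem_cat, inE) => /or3P[]->; rewrite ?orbT.
  - by apply: contraNneq nI => <-; apply: map_f.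
  - by apply: contraNneq nK => <-; apply: map_f.
have oldE2 : perm_eq (eps :: atoms F ++ e2 :: outs old) (enum (fE B)).
  rewrite -(permPr edge) evsE flatten_map_split outC /= /old !map_cat !flatten_cat.
  apply/permP => p; rewrite /= !count_cat /= !count_cat /= (permP outI) /=; clear; lia.
have keepVE v : keepV eps v = (v != iota) && (v != kap).
  by rewrite /keepV upE loE.
have insv (v : VA eps) : insub (val v) = Some v by apply: valK.
pose wW (v : fV (splitW eps)) := odflt iota (omap val v).
pose wK (v : fV (splitCW eps)) := odflt kap (omap val v).
have valN (v : VA eps) : val v != iota /\ val v != kap.
  by apply/andP; rewrite -keepVE; apply: valP.
have wWI : injective wW.
  move=> [u|] [v|] //= uv; first by congr Some; apply: val_inj.
    by case/eqP: (valN u).1; apply: uv.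
  by case/eqP: (valN v).1; apply: esym.
have wKI : injective wK.
  move=> [u|] [v|] //= uv; first by congr Some; apply: val_inj.
    by case/eqP: (valN u).2; apply: uv.
  by case/eqP: (valN v).2; apply: esym.
have eps_top : eps \notin ftop B by apply/negP => /uptop; rewrite upE.
have eps_bot : eps \notin fbot B by apply/negP => /lobot; rewrite loE.
have valEA s : eps \notin s -> map val (pmap insub s : seq (EA eps)) = s.
  move=> nin; rewrite (pmap_filter (@insubK _ _ _)); apply/all_filterP/allP => e ein.
  by rewrite insubT //; apply: contraNneq nin => <-.
have edges_del s : perm_eq (eps :: s) (enum (fE B)) ->
    perm_eq s (map val (enum (EA eps))).
  move=> ps; apply: perm_map_enum_del ps val_inj _ => e; split=> [ne|[u ->]].
    by exists (Sub e ne : EA eps); rewrite SubK.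
  exact: (valP u).
have fupA (e : EA eps) (v : VA eps) : fup (val e) = Some (val v) -> upA e = Some v.
  by rewrite /upA => ->; apply: insv.
have floA (e : EA eps) (v : VA eps) : flo (val e) = Some (val v) -> loA e = Some v.
  by rewrite /loA => ->; apply: insv.
pose EW : event (fE B) (fV B) := Ev AWeak (ev_vtx EI) [::] [:: e2].
pose EK : event (fE B) (fV B) := Ev ACoweak (ev_vtx EC) [:: e3] [::].
have inW ev : ev \in evs1 ++ EW :: evs2 ++ evs3 -> ev = EW \/ ev \in old.
  rewrite !(mem_cat, inE); case/or4P => [->|/eqP|->|->]; rewrite ?orbT; by [right | left].
have inK ev : ev \in evs1 ++ evs2 ++ EK :: evs3 -> ev = EK \/ ev \in old.
  rewrite !(mem_cat, inE); case/or4P => [->|->|/eqP|->]; rewrite ?orbT; by [right | left].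
have oldW ev v : ev \in old -> ev_vtx ev = wW v -> 
    exists2 u, v = Some u & ev \in evs /\ ev_vtx ev = val u.
  move=> /oldP[evin nI nK]; case: v => [u|] /= vE; first by exists u.
  by rewrite vE eqxx in nI.
have oldK ev v : ev \in old -> ev_vtx ev = wK v -> 
    exists2 u, v = Some u & ev \in evs /\ ev_vtx ev = val u.
  move=> /oldP[evin nI nK]; case: v => [u|] /= vE; first by exists u.
  by rewrite vE eqxx in nK.
exists e2, e3, wW, wK; do 2!eexists; split=> //.
- split; first exact: trW.
  + by rewrite top valEA.
  + by rewrite /= bot eps3E valEA // mem_cat negb_or eps_bot inE eq_sym.
  + apply: (@perm_map_enum_del _ _ kap) wWI _ => [|x].
      rewrite -(permPr oldE); apply/permP => p.
      by rewrite !map_cat /= !map_cat vI /= !count_cat /= !count_cat; clear; lia.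
    split=> [nx|[[u|] ->]]; [|exact: (valN u).2 | exact: IK].
    case: (eqVneq x iota) => [->|nI]; first by exists None.
    have kx : keepV eps x by rewrite keepVE nI.
    by exists (Some (Sub x kx : VA eps)).
  + apply: edges_del; rewrite -(permPr oldE2); apply/permP => p.
    rewrite !map_cat /= !map_cat !flatten_cat /= !flatten_cat /=.
    by rewrite !count_cat /= !count_cat; clear; lia.
  + move=> ev v /inW[->|evin vE].
      by rewrite /= vI -[iota]/(wW None) => /wWI <-.
    by have [u -> [/lab labE /labE]] := oldW _ _ evin vE.
  + move=> ev v e /inW[->|evin vE ein].
      by rewrite /= vI -[iota]/(wW None) => /wWI <-; rewrite inE eps2E => /eqP->; rewrite eqxx.
    have [u -> [evin' vu]] := oldW _ _ evin vE.
    have := up _ _ _ evin' vu ein => upe; rewrite /= eps2E (fupA _ _ upe).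
    case: eqP => // -[e2e]; move: up2; rewrite -e2e upe => -[uE].
    by case/eqP: (valN u).1; apply: uE.
  + move=> ev v e /inW[-> //|evin vE ein].
    have [u -> [evin' vu]] := oldW _ _ evin vE.
    by rewrite /= (floA _ _ (lo _ _ _ evin' vu ein)).
  + move=> e; rewrite mem_pmap_sub => /uptop upe; rewrite /= eps2E /upA upe.
    by case: eqP => // -[e2e]; move: up2; rewrite -e2e upe.
  (* The lower end of [e3] was the deleted cut, so [insub] fails there and the edge now ends at the
     bottom. *)
  + move=> e; rewrite mem_pmap_sub mem_cat eps3E inE /= /loA.
    case/orP=> [/lobot->//|/eqP ee]; move: lo3; rewrite -ee => -> /=; rewrite insubN //.
    by rewrite keepVE eqxx andbF.
- split; first exact: trK.
  + by rewrite /= top eps2E valEA // mem_cat negb_or eps_top inE eq_sym.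
  + by rewrite bot valEA.
  + apply: (@perm_map_enum_del _ _ iota) wKI _ => [|x].
      rewrite -(permPr oldE); apply/permP => p.
      by rewrite !map_cat /= vC !count_cat /=; clear; lia.
    split=> [nx|[[u|] ->]]; [|exact: (valN u).1 | by rewrite eq_sym; exact: IK].
    case: (eqVneq x kap) => [->|nK]; first by exists None.
    have kx : keepV eps x by rewrite keepVE nx.
    by exists (Some (Sub x kx : VA eps)).
  + apply: edges_del; rewrite -(permPr oldE2); apply/permP => p.
    by rewrite !map_cat /= !flatten_cat /= !count_cat /= !count_cat; clear; lia.
  + move=> ev v /inK[->|evin vE].
      by rewrite /= vC -[kap]/(wK None) => /wKI <-.
    by have [u -> [/lab labE /labE]] := oldK _ _ evin vE.
  + move=> ev v e /inK[-> //|evin vE ein].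
    have [u -> [evin' vu]] := oldK _ _ evin vE.
    by rewrite /= (fupA _ _ (up _ _ _ evin' vu ein)).
  + move=> ev v e /inK[->|evin vE ein].
      by rewrite /= vC -[kap]/(wK None) => /wKI <-; rewrite inE eps3E => /eqP->; rewrite eqxx.
    have [u -> [evin' vu]] := oldK _ _ evin vE.
    have := lo _ _ _ evin' vu ein => loe; rewrite /= eps3E (floA _ _ loe).
    case: eqP => // -[e3e]; move: lo3; rewrite -e3e loe => -[uE].
    by case/eqP: (valN u).2; apply: uE.
  + move=> e; rewrite mem_pmap_sub mem_cat eps2E inE /= /upA.
    case/orP=> [/uptop->//|/eqP ee]; move: up2; rewrite -ee => -> /=; rewrite insubN //.
    by rewrite keepVE eqxx.
  + move=> e; rewrite mem_pmap_sub => /lobot loe; rewrite /= eps3E /loA loe.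
    by case: eqP => // -[e3e]; move: lo3; rewrite -e3e loe.
Qed.
End SplitTraced.

Lemma all_in_cat (T : eqType) (P : T -> Prop) (s t : seq T) :
  {in s ++ t, forall x, P x} -> {in s, forall x, P x} /\ {in t, forall x, P x}.
Proof. by move=> Pst; split=> x xin; apply: Pst; rewrite mem_cat xin ?orbT. Qed.

(** * Duplicating and merging formulae by atomic steps *)

Section Duplicate.
Variables (A : eqType) (bar : A -> A) (E : eqType) (lam : E -> A) (V : eqType).
Variables (I : eqType) (f0 f1 f2 : I -> E) (v : I -> V).

(** Cocontraction descends to the atoms: medial separates the two copies of a disjunction,
    regrouping those of a conjunction, and units are doubled by equations. Each leaf contributes one
    event, in reading order. *)
Lemma trace_cocontract (f : form I) :
  {in atoms f, forall i, lam (f1 i) = lam (f0 i) /\ lam (f2 i) = lam (f0 i)} ->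
  trace bar lam (fmap f0 f)
    [seq Ev ACocont (v i) [:: f0 i] [:: f1 i; f2 i] | i <- atoms f]
    (FAnd (fmap f1 f) (fmap f2 f)).
Proof.
elim: f => [||i|a IHa b IHb|a IHa b IHb] lamE /=.
- exact: (@trace_sapply _ _ _ _ _ SFFI).
- exact: (@trace_sapply _ _ _ _ _ SUnitAndI).
- have [l1 l2] := lamE i (mem_head _ _).
  apply: (trace_event (x := lam (f0 i)) (v i)); first constructor.
  by rewrite /= l1 l2.
- have [/IHa{}IHa /IHb{}IHb] := all_in_cat lamE.
  rewrite map_cat; apply: trace_transr (trace_or IHa IHb) _.
  exact: (@trace_sapply _ _ _ _ _ SMedial).
- have [/IHa{}IHa /IHb{}IHb] := all_in_cat lamE.
  rewrite map_cat; apply: trace_transr (trace_and IHa IHb) _.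
  have refl c : trace bar lam c ([::] : seq (event E V)) c by apply: tr_nil.
  apply: trace_trans (trace_andA _ _ _ _ _ _) _.
  apply: (@trace_trans _ _ _ _ _
    (FAnd (fmap f1 a) (FAnd (fmap f1 b) (FAnd (fmap f2 a) (fmap f2 b))))).
    apply: (@trace_plug _ _ _ _ _ (CAndR _ Hole)).
    apply: (@trace_trans _ _ _ _ _ (FAnd (FAnd (fmap f2 a) (fmap f1 b)) (fmap f2 b))).
      exact: (@trace_sapply _ _ _ _ _ SAssocAnd).
    apply: trace_trans (trace_andA _ _ _ _ _ _).
    exact: trace_and (trace_andC _ _ _ _ _) (refl _).
  exact: (@trace_sapply _ _ _ _ _ SAssocAnd).
Qed.

(** The dual induction: here medial is needed for conjunctions and regrouping for disjunctions. *)
Lemma trace_contract (f : form I) :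
  {in atoms f, forall i, lam (f1 i) = lam (f0 i) /\ lam (f2 i) = lam (f0 i)} ->
  trace bar lam (FOr (fmap f1 f) (fmap f2 f))
    [seq Ev ACont (v i) [:: f1 i; f2 i] [:: f0 i] | i <- atoms f]
    (fmap f0 f).
Proof.
elim: f => [||i|a IHa b IHb|a IHa b IHb] lamE /=.
- exact: (@trace_sapply _ _ _ _ _ SUnitOr).
- exact: (@trace_sapply _ _ _ _ _ STT).
- have [l1 l2] := lamE i (mem_head _ _).
  apply: (trace_event (x := lam (f0 i)) (v i)); first constructor.
  by rewrite /= l1 l2.
- have [/IHa{}IHa /IHb{}IHb] := all_in_cat lamE.
  rewrite map_cat; apply: trace_trans (trace_or IHa IHb).
  have refl c : trace bar lam c ([::] : seq (event E V)) c by apply: tr_nil.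
  apply: trace_trans (trace_orA _ _ _ _ _ _) _.
  apply: (@trace_trans _ _ _ _ _
    (FOr (fmap f1 a) (FOr (fmap f2 a) (FOr (fmap f1 b) (fmap f2 b))))).
    apply: (@trace_plug _ _ _ _ _ (COrR _ Hole)).
    apply: (@trace_trans _ _ _ _ _ (FOr (FOr (fmap f1 b) (fmap f2 a)) (fmap f2 b))).
      exact: (@trace_sapply _ _ _ _ _ SAssocOr).
    apply: trace_trans (trace_orA _ _ _ _ _ _).
    exact: trace_or (trace_orC _ _ _ _ _) (refl _).
  exact: (@trace_sapply _ _ _ _ _ SAssocOr).
- have [/IHa{}IHa /IHb{}IHb] := all_in_cat lamE.
  rewrite map_cat; apply: trace_trans (trace_and IHa IHb).
  exact: (@trace_sapply _ _ _ _ _ SMedial).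
Qed.

End Duplicate.

(** * Gluing two traces *)

Lemma perm_enum_cover (T : finType) (s : seq T) :
  (forall x, x \in s) -> size s <= #|T| -> perm_eq s (enum T).
Proof.
move=> sT; rewrite cardE => ss; have sub : {subset enum T <= s} by move=> x _.
apply: uniq_perm; rewrite ?enum_uniq ?(leq_size_uniq (enum_uniq T) sub) // => x.
by rewrite sT mem_enum.
Qed.

Lemma pos_nth (T : eqType) n (s : seq T) x (i : 'I_n) :
  uniq s -> i < size s -> pos n s (nth x s i) = Some i.
Proof. by move=> us si; rewrite /pos index_uniq // valK. Qed.

Lemma pos_None (T : eqType) n (s : seq T) x : n <= index x s -> pos n s x = None.
Proof. by move=> ns; rewrite /pos insubN // -leqNgt. Qed.

Lemma pos_notin (T : eqType) n (s : seq T) x :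
  n <= size s -> x \notin s -> pos n s x = None.
Proof. by move=> ns xs; apply: pos_None; rewrite (memNindex xs). Qed.

(** Reads a formula whose leaves are indices as a formula over boundary edges. The list [s] may be
    longer than [n], since one boundary of [D1] and one of [D2] end with the extra edge to be
    glued. *)
Lemma fmap_nth X Y (x0 : X) (r : X -> Y) n (s : seq X) (f : form 'I_n) g :
  shape f = shape g -> atoms f = enum 'I_n -> atoms g = take n s -> n <= size s ->
  fmap (fun i : 'I_n => r (nth x0 s i)) f = fmap r g.
Proof.
move=> fg fE gE ns; apply: form_ext; first by rewrite !subst_comp.
rewrite !atoms_fmap fE gE (map_comp r (fun i : 'I_n => nth x0 s i)).
by rewrite (map_comp (nth x0 s) val) val_enum_ord map_nth_iota0.
Qed.

(** The namings of [D1] and [D2] are unrelated; only their boundary labels agree, through [P], [Q]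
    and [b]. All events of [D1] precede those of [D2], since the glued edge runs from the former to
    the latter. *)
Lemma glue_traced (A : eqType) (bar : A -> A) (B D1 D2 : flow)
    (lam1 : fE D1 -> A) (lam2 : fE D2 -> A) P Q b F1 F2 G1 G2
    (evs1 : seq (event (fE D1) (fV D1))) (evs2 : seq (event (fE D2) (fV D2))) :
  size (atoms P) = size (ftop B) -> size (atoms Q) = size (fbot B) ->
  traced bar id id lam1 F1 evs1 G1 -> traced bar id id lam2 F2 evs2 G2 ->
  fmap lam1 F1 = P -> fmap lam1 G1 = FOr Q (At b) ->
  fmap lam2 F2 = FAnd P (At b) -> fmap lam2 G2 = Q ->
  exists (lam : fE (glue B D1 D2) -> A) F evs G,
    [/\ fmap lam F = P, fmap lam G = Q
      & traced bar id (id : fV (glue B D1 D2) -> _) lam F evs G].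
Proof.
move=> sP sQ [tr1]; rewrite !map_id => top1 bot1 vtx1 edge1 lab1 up1 lo1 uptop1 lobot1.
move=> [tr2]; rewrite !map_id => top2 bot2 vtx2 edge2 lab2 upD2 loD2 uptop2 lobot2.
move=> F1P; case: G1 tr1 bot1 => // G1 [] // x3 tr1 bot1 [G1Q x3b].
case: F2 tr2 top2 edge2 => // F2 [] // x2 tr2 top2 edge2 [F2P x2b] G2Q.
set h := size (ftop B) in sP *; set k := size (fbot B) in sQ *.
rewrite /= in bot1 top2 edge2.
have sF1 : size (atoms F1) = h by rewrite -sP -F1P size_atoms_fmap.
have sG1 : size (atoms G1) = k by rewrite -sQ -G1Q size_atoms_fmap.
have sF2 : size (atoms F2) = h by rewrite -sP -F2P size_atoms_fmap.
have sG2 : size (atoms G2) = k by rewrite -sQ -G2Q size_atoms_fmap.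
have st1 : size (ftop D1) = h by rewrite -top1.
have st2 : size (ftop D2) = h.+1 by rewrite -top2 size_cat addn1 sF2.
have sb1 : size (fbot D1) = k.+1 by rewrite -bot1 size_cat addn1 sG1.
have sb2 : size (fbot D2) = k by rewrite -bot2.
have uniqE D (F G : form (fE D)) (evs : seq (event (fE D) (fV D))) lam :
    trace bar lam F evs G -> perm_eq (atoms F ++ outs evs) (enum (fE D)) ->
    uniq (atoms F) /\ uniq (atoms G).
  move=> tr edge; have : uniq (atoms F ++ outs evs) by rewrite (perm_uniq edge) enum_uniq.
  move=> u; split; first by move: u; rewrite cat_uniq => /andP[].
  by move: u; rewrite (perm_uniq (trace_balance tr)) cat_uniq => /and3P[].
have [ut1 ub1] := uniqE _ _ _ _ _ tr1 edge1; have [ut2 ub2] := uniqE _ _ _ _ _ tr2 edge2.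
rewrite /= top1 bot1 in ut1 ub1; rewrite /= top2 bot2 in ut2 ub2.
have e3E : e3t B D1 = Some x3 by rewrite /e3t -bot1 -/k -sG1 drop_size_cat.
have e2E : e2h B D2 = Some x2 by rewrite /e2h -top2 -/h -sF2 drop_size_cat.
have keepE f : keep2 B f = (f != x2) by rewrite /keep2 e2E.
pose r1 (e : fE D1) : GE B D1 D2 := inl (inl e).
(* The default value is the gluing: the only edge of [D2] that is not kept is [x2], and it receives
   the name of [x3]. *)
pose r2 (f : fE D2) : GE B D1 D2 :=
  if insub f is Some u then inl (inr u) else inl (inl x3).
pose w1 (v : fV D1) : GV B D1 D2 := inl (inl v).
pose w2 (v : fV D2) : GV B D1 D2 := inl (inr v).
pose lam (e : GE B D1 D2) : A := match e with
  | inl (inl e) => lam1 e | inl (inr f) => lam2 (val f)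
  | inr (inl i) => nth b (atoms P) i | inr (inr j) => nth b (atoms Q) j end.
(* [Fi] and [Gi] have the shapes of [P] and [Q] with leaves numbered in order, so that the three
   edges meeting at a new vertex share one index. *)
have [Fi shF atF] := @form_relabel _ _ P (enum 'I_h) (etrans (size_enum_ord h) (esym sP)).
have [Gi shG atG] := @form_relabel _ _ Q (enum 'I_k) (etrans (size_enum_ord k) (esym sQ)).
pose f0 (i : 'I_h) : GE B D1 D2 := inr (inl i).
pose f1 (i : 'I_h) := r1 (nth x3 (ftop D1) i).
pose f2 (i : 'I_h) := r2 (nth x2 (ftop D2) i).
pose g0 (j : 'I_k) : GE B D1 D2 := inr (inr j).
pose g1 (j : 'I_k) := r1 (nth x3 (fbot D1) j).
pose g2 (j : 'I_k) := r2 (nth x2 (fbot D2) j).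
have lr1 : lam \o r1 =1 lam1 by [].
have lr2 : lam \o r2 =1 lam2.
  move=> f; rewrite /= /r2; case: insubP => [u _ <- //|nk].
  have : ~~ keep2 B f := nk.
  by rewrite keepE negbK => /eqP-> /=; rewrite x3b x2b.
have Ff1 : fmap f1 Fi = fmap r1 F1.
  apply: fmap_nth; rewrite ?st1 //; first by rewrite shF -F1P subst_comp.
  by rewrite -top1 take_oversize // sF1.
have Ff2 : fmap f2 Fi = fmap r2 F2.
  apply: fmap_nth; rewrite ?st2 //; first by rewrite shF -F2P subst_comp.
  by rewrite -top2 take_size_cat.
have Gg1 : fmap g1 Gi = fmap r1 G1.
  apply: fmap_nth; rewrite ?sb1 //; first by rewrite shG -G1Q subst_comp.
  by rewrite -bot1 take_size_cat.
have Gg2 : fmap g2 Gi = fmap r2 G2.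
  apply: fmap_nth; rewrite ?sb2 //; first by rewrite shG -G2Q subst_comp.
  by rewrite -bot2 take_oversize // sG2.
have lf i : lam (f1 i) = lam (f0 i) /\ lam (f2 i) = lam (f0 i).
  rewrite /f1 /f2 [lam (r2 _)]lr2 /= -F1P atoms_fmap (nth_map x3) ?sF1 // top1; split=> //.
  rewrite -top1 -(nth_map _ b lam1) ?sF1 // -atoms_fmap F1P -F2P atoms_fmap.
  by rewrite (nth_map x2) ?sF2 // -top2 nth_cat sF2 ltn_ord.
have lg j : lam (g1 j) = lam (g0 j) /\ lam (g2 j) = lam (g0 j).
  rewrite /g1 /g2 [lam (r2 _)]lr2 /= -G2Q atoms_fmap (nth_map x2) ?sG2 // bot2; split=> //.
  rewrite -bot2 -(nth_map _ b lam2) ?sG2 // -atoms_fmap G2Q -G1Q atoms_fmap.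
  by rewrite (nth_map x3) ?sG1 // -bot1 nth_cat sG1 ltn_ord.
pose evc :=
  [seq Ev ACocont (inr (inl i) : GV B D1 D2) [:: f0 i] [:: f1 i; f2 i] | i <- atoms Fi].
pose evd :=
  [seq Ev ACont (inr (inr j) : GV B D1 D2) [:: g1 j; g2 j] [:: g0 j] | j <- atoms Gi].
pose ev1 := map (emap r1 w1) evs1; pose ev2 := map (emap r2 w2) evs2.
have tc : trace bar lam (fmap f0 Fi) evc (FAnd (fmap f1 Fi) (fmap f2 Fi)).
  by apply: trace_cocontract => i _; apply: lf.
have td : trace bar lam (FOr (fmap g1 Gi) (fmap g2 Gi)) evd (fmap g0 Gi).
  by apply: trace_contract => j _; apply: lg.
have t1 := trace_map w1 lr1 tr1; have t2 := trace_map w2 lr2 tr2.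
have x32 : r1 x3 = r2 x2.
  by rewrite /r2 insubN //; rewrite keepE eqxx.
have tall : trace bar lam (fmap f0 Fi) (evc ++ ev1 ++ ev2 ++ evd) (fmap g0 Gi).
  apply: trace_cat tc _; rewrite Ff1 Ff2.
  apply: trace_cat (trace_plug (CAndL Hole (fmap r2 F2)) t1) _ => /=.
  apply: (@trace_trans _ _ _ _ _ (FOr (fmap r2 (FAnd F2 (At x2))) (fmap r1 G1))).
    apply: trace_trans (trace_andC _ _ _ _ _) _ => /=; rewrite -x32.
    apply: (@trace_trans _ _ _ _ _ (FAnd (fmap r2 F2) (FOr (At (r1 x3)) (fmap r1 G1)))).
      by apply: (@trace_plug _ _ _ _ _ (CAndR (fmap r2 F2) Hole)); apply: trace_orC.
    exact: trace_switch.
  apply: trace_cat (trace_plug (COrL Hole (fmap r1 G1)) t2) _ => /=.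
  apply: trace_trans (trace_orC _ _ _ _ _) _; rewrite -Gg1 -Gg2; exact: td.
have r2E f (kf : keep2 B f) : r2 f = inl (inr (Sub f kf)) by rewrite /r2 insubT.
have inE1 e : e \in atoms F1 ++ outs evs1 by rewrite (perm_mem edge1) mem_enum.
have inE2 e : e \in (atoms F2 ++ [:: x2]) ++ outs evs2 by rewrite (perm_mem edge2) mem_enum.
have outs_emap E E' V V' (f : E -> E') (w : V -> V') (evs : seq (event E V)) :
  outs (map (emap f w) evs) = map f (outs evs) by rewrite map_flatten -!map_comp.
have outc : outs evc = flatten [seq [:: f1 i; f2 i] | i <- enum 'I_h].
  by rewrite -map_comp atF.
have outd : outs evd = map g0 (enum 'I_k).
  by rewrite -map_comp atG; elim: (enum _) => //= j s ->.
have x3bot : x3 \in fbot D1 by rewrite -bot1 mem_cat inE eqxx orbT.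
have nx2 i : nth x2 (ftop D2) (i : 'I_h) != x2.
  move: ut2; rewrite -top2 cat_uniq nth_cat sF2 ltn_ord /= orbF andbT => /andP[_].
  by apply: contraNneq => {1}<-; rewrite mem_nth // sF2.
(* The edge [x3] stands at index [k], one beyond the lower edges that receive a contraction, so
   [glo] falls through to its [e3t] clause. *)
have x3pos : pos k (fbot D1) x3 = None.
  apply: pos_None; move: ub1; rewrite -bot1 cat_uniq index_cat /= orbF andbT.
  by case/andP=> _ /negPf->; rewrite sG1 leq_addr.
have vtx_emap E E' V V' (f : E -> E') (w : V -> V') (evs : seq (event E V)) :
  vtxs (map (emap f w) evs) = map w (vtxs evs) by rewrite -!map_comp.
have vtxall : perm_eq (vtxs (evc ++ ev1 ++ ev2 ++ evd)) (enum (GV B D1 D2)).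
  have vc : vtxs evc = map (fun i => inr (inl i)) (enum 'I_h) by rewrite -map_comp atF.
  have vd : vtxs evd = map (fun j => inr (inr j)) (enum 'I_k) by rewrite -map_comp atG.
  rewrite !map_cat vc vd !vtx_emap.
  (* Every vertex is listed and the sizes agree; this spares a proof that the four pieces are
     disjoint. *)
  apply: perm_enum_cover => [v|].
    rewrite !mem_cat; case: v => [[v|v]|[i|j]].
    - by rewrite (map_f w1) ?orbT // (perm_mem vtx1) mem_enum.
    - by rewrite (map_f w2) ?orbT // (perm_mem vtx2) mem_enum.
    - by rewrite (map_f (fun i => inr (inl i))) // mem_enum.
    - by rewrite (map_f (fun i => inr (inr i))) ?orbT // mem_enum.
  rewrite !size_cat !(size_map _ (vtxs _)) !(size_map _ (enum _)) !size_enum_ord.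
  rewrite (perm_size vtx1) (perm_size vtx2) -!cardE !card_sum !card_ord -/h -/k.
  have arith a b' : h + (a + (b' + k)) <= a + b' + (h + k) by clear; lia.
  exact: arith.
have edgeall : perm_eq (atoms (fmap f0 Fi) ++ outs (evc ++ ev1 ++ ev2 ++ evd))
    (enum (GE B D1 D2)).
  rewrite !map_cat !flatten_cat outc outd !outs_emap atoms_fmap atF.
  apply: perm_enum_cover => [e|].
    rewrite !mem_cat; case: e => [[e|u]|[i|j]].
    - have := inE1 e; rewrite mem_cat top1 => /orP[et|eo].
        have ei : index e (ftop D1) < h by rewrite -st1 index_mem.
        suff -> : inl (inl e) \in flatten [seq [:: f1 i; f2 i] | i <- enum 'I_h].
          by rewrite !orbT.
        apply/flatten_mapP; exists (Ordinal ei); rewrite ?mem_enum //.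
        by rewrite inE /f1 /= nth_index ?eqxx.
      by rewrite (map_f r1) ?orbT.
    - have kf : keep2 B (val u) := valP u.
      have ur : inl (inr u) = r2 (val u) by rewrite /r2 valK.
      have := inE2 (val u); rewrite mem_cat top2 => /orP[et|eo].
        have ei : index (val u) (ftop D2) < h.
          move: et; rewrite keepE in kf; rewrite -top2 mem_cat inE (negPf kf) orbF => et.
          by rewrite index_cat et -sF2 index_mem.
        suff -> : inl (inr u) \in flatten [seq [:: f1 i; f2 i] | i <- enum 'I_h].
          by rewrite !orbT.
        apply/flatten_mapP; exists (Ordinal ei); rewrite ?mem_enum //.
        by rewrite !inE ur /f2 /= nth_index ?eqxx ?orbT.
      by rewrite ur (map_f r2) ?orbT.
    - by rewrite (map_f f0) // mem_enum.
    - by rewrite (map_f g0) ?orbT // mem_enum.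
  have sfl s : size (flatten [seq [:: f1 i; f2 i] | i <- s]) = (size s).*2.
    by elim: s => //= i s ->.
  rewrite !size_cat sfl !(size_map _ (enum _)) !(size_map _ (outs _)) !size_enum_ord.
  have := perm_size edge1; rewrite size_cat sF1 -cardE.
  have := perm_size edge2; rewrite !size_cat sF2 -cardE /=.
  have ck : #|{: {f : fE D2 | keep2 B f}}| = #|fE D2|.-1.
    rewrite card_sig -(cardC1 x2); apply: eq_card => f.
    by rewrite !inE keepE.
  rewrite !card_sum !card_ord ck -/h -/k.
  (* Here [a] and [b'] count the edges of [D1] and [D2]. The extra 1 is the upper edge [x2] of [D2],
     which [GE] drops, whence [b'.-1]. *)
  have arith a b' o1 o2 : h + 1 + o2 = b' -> h + o1 = a ->
    h + (h.*2 + (o1 + (o2 + k))) <= a + b'.-1 + (h + k) by clear; lia.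
  exact: arith.
(* This covers the dropped edge as well: the edge [x3], which bears its name, takes over its lower
   end. *)
have glo_r2 f : @glo B D1 D2 (r2 f) = lo2 B D1 f.
  case: (boolP (keep2 B f)) => [kf|]; first by rewrite r2E.
  rewrite keepE negbK => /eqP->; rewrite -x32 /= -/k x3pos.
  by rewrite e3E eqxx e2E.
have allP (R : event (GE B D1 D2) (GV B D1 D2) -> Prop) :
    (forall i, R (Ev ACocont (inr (inl i)) [:: f0 i] [:: f1 i; f2 i])) ->
    (forall ev, ev \in evs1 -> R (emap r1 w1 ev)) ->
    (forall ev, ev \in evs2 -> R (emap r2 w2 ev)) ->
    (forall j, R (Ev ACont (inr (inr j)) [:: g1 j; g2 j] [:: g0 j])) ->
    forall ev, ev \in evc ++ ev1 ++ ev2 ++ evd -> R ev.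
  move=> Rc R1 R2 Rd ev; rewrite !mem_cat.
  by case/or4P=> /mapP[x xin ->]; [apply: Rc | apply: R1 | apply: R2 | apply: Rd].
exists lam, (fmap f0 Fi), (evc ++ ev1 ++ ev2 ++ evd), (fmap g0 Gi); split.
- rewrite subst_comp -[RHS]subst_At; apply: (fmap_nth b id) => //; last by rewrite sP.
  by rewrite take_oversize // sP.
- rewrite subst_comp -[RHS]subst_At; apply: (fmap_nth b id) => //; last by rewrite sQ.
  by rewrite take_oversize // sQ.
split; rewrite ?map_id //.
- by rewrite atoms_fmap atF.
- by rewrite atoms_fmap atG.
- move=> ev v evin <- {v}; move: ev evin; apply: allP => //= ev evin.
    exact: lab1 evin _.
  exact: lab2 evin _.
- move=> ev v e evin <- {v}; move: ev evin e.
  apply: allP => [i|ev evin|ev evin|j] e /=.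
  + rewrite !inE => /orP[]/eqP->; first by rewrite /= pos_nth // st1.
    have kf : keep2 B (nth x2 (ftop D2) i) by rewrite keepE.
    by rewrite /f2 (r2E _ kf) /= /up2 pos_nth // st2 ltnW // ltnS.
  + case/mapP=> f fin ->; have fu := up1 _ _ _ evin (erefl _) fin.
    rewrite /= -/h pos_notin ?fu ?st1 //.
    by apply/negP => /uptop1; rewrite fu.
  + case/mapP=> f fin ->; have fu := upD2 _ _ _ evin (erefl _) fin.
    have ft : f \notin ftop D2 by apply/negP => /uptop2; rewrite fu.
    (* An output of an event is not an upper edge of [D2], so it cannot be the dropped [x2]. *)
    have kf : keep2 B f.
      by rewrite keepE; apply: contraNneq ft => ->; rewrite -top2 mem_cat inE eqxx orbT.
    by rewrite (r2E _ kf) /= /up2 -/h pos_notin ?fu ?st2.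
  + by rewrite inE => /eqP->.
- move=> ev v e evin <- {v}; move: ev evin e.
  apply: allP => [i|ev evin|ev evin|j] e /=.
  + by rewrite inE => /eqP->.
  + case/mapP=> f fin ->; have fl := lo1 _ _ _ evin (erefl _) fin.
    have fb : f \notin fbot D1 by apply/negP => /lobot1; rewrite fl.
    rewrite /= -/k pos_notin ?sb1 // e3E fl.
    by case: eqP => // -[fx]; rewrite fx x3bot in fb.
  + case/mapP=> f fin ->; have fl := loD2 _ _ _ evin (erefl _) fin.
    have fb : f \notin fbot D2 by apply/negP => /lobot2; rewrite fl.
    by rewrite [LHS]glo_r2 /lo2 -/k pos_notin ?sb2 // fl.
  + rewrite !inE => /orP[]/eqP->.
      by rewrite /= -/k pos_nth // sb1 ltnW // ltnS.
    by rewrite [LHS]glo_r2 /lo2 -/k pos_nth // sb2.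
- by move=> e /mapP[i _ ->].
- by move=> e /mapP[j _ ->].
Qed.

Theorem theorem5p13 (A : eqType) (bar : A -> A)
  (barK : involutive bar) (bar_neq : forall a, bar a != a) :
  forall R : flow -> flow -> Prop, R = red_bc \/ R = red_ex ->
  forall B C : flow, R B C ->
  forall (P Q : form A) (Phi : seq (step A)),
    derivation bar P Phi Q -> flow_iso (flow_of P Phi) B ->
    exists Psi : seq (step A),
      derivation bar P Psi Q /\ flow_iso (flow_of P Psi) C.
Proof.
(* Premiss and conclusion stay universally quantified, since the induction hypotheses are applied
   with an extra atom in one or the other. *)
pose sound (B C : flow) := forall P Q Phi,
  derivation bar P Phi Q -> flow_iso (flow_of P Phi) B ->
  exists Psi, derivation bar P Psi Q /\ flow_iso (flow_of P Psi) C.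
have split B (eps : fE B) D1 D2 : simple eps ->
    sound (splitW eps) D1 -> sound (splitCW eps) D2 -> sound B (glue B D1 D2).
  move=> seps IH1 IH2 P Q Phi der iso.
  have [a0] := flow_edge_inhabited eps der iso.
  have [lam [F [evs [G [FP GQ tr]]]]] := flow_traced a0 der iso.
  have [e2 [e3 [wW [wK [evsW [evsK [lam23 wWI wKI trW trK]]]]]]] :=
    split_traced barK tr seps.
  have [Psi1 [der1 iso1]] := traced_flow (C := splitW eps) (@val_inj _ _ (EA eps)) wWI trW.
  have [Psi2 [der2 iso2]] := traced_flow (C := splitCW eps) (@val_inj _ _ (EA eps)) wKI trK.
  have [Psi1' [/(flow_traced a0)H1 /H1]] := IH1 _ _ _ der1 iso1.
  move=> [lam1 [F1 [evs1 [G1 [FP1 GQ1 tr1]]]]].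
  have [Psi2' [/(flow_traced a0)H2 /H2]] := IH2 _ _ _ der2 iso2.
  move=> [lam2 [F2 [evs2 [G2 [FP2 GQ2 tr2]]]]].
  rewrite /= FP in FP1; rewrite /= GQ in GQ1.
  (* With [lam23] the atom conjoined to [P] becomes the one disjoined to [Q], namely the shared [b]
     of [glue_traced]. *)
  rewrite /= FP lam23 in FP2; rewrite /= GQ in GQ2.
  have sP : size (atoms P) = size (ftop B).
    by rewrite -FP size_atoms_fmap (traced_top tr) size_map.
  have sQ : size (atoms Q) = size (fbot B).
    by rewrite -GQ size_atoms_fmap (traced_bot tr) size_map.
  have [lam' [F' [evs' [G' [<- <- tr']]]]] := glue_traced sP sQ tr1 tr2 FP1 GQ1 FP2 GQ2.
  exact: (@traced_flow _ _ (glue B D1 D2) _ _ id id _ _ _ _ (@inj_id _) (@inj_id _) tr').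
move=> R [] -> B C; elim=> {B C} [B _ P Q Phi der iso|B eps D1 D2].
- by exists Phi.
- by move=> seps _ _ IH1 _; apply: split.
- by exists Phi.
- by move=> [p [m [_ [seps _]]]] _ IH1 _; apply: split.
Qed.
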